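(* Let $(\Sigma,\xi,\tau,\Pi,c,\Omega)$ be a two-plane system, let $a\in\Pi$ satisfy $\Omega(a,c)=1$, and let $K\in\mathbb{R}$ be any given real number. Define $(q,\lambda,\mu):\Sigma\to V=\Pi\times[\Pi^*]^{\odot2}\times[\Pi^*]^{\odot2}$ by $q=0$, $\mu=0$, with the component functions of $\lambda$ relative to the basis $c,a$ of $\Pi$ chosen so that $\lambda(c,c)$ equals a constant minus the coordinate function $y^1$, while $\lambda(a,a)$ and $\lambda(a,c)$ are arbitrary ($C^\infty$) functions of $y^1$ only. Then $\Sigma\times\Pi_+$, with the metric $\tilde g$ constructed from $(q,\lambda,\mu)$ and $K$ as described in the context and with a suitable orientation, is a strictly non-Walker self-dual neutral Einstein four-manifold of Petrov type III with the scalar curvature $12K$, which is not locally homogeneous.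
   Context: Manifolds are connected; all objects are of class $C^\infty$. **Curvature and Petrov type.** On a pseudo-Riemannian four-manifold $(M,g)$ of the neutral signature $(-,-,+,+)$ with Levi-Civita connection $\nabla$, set $R(u,v)w=\nabla_v\nabla_uw-\nabla_u\nabla_vw+\nabla_{[u,v]}w$ and $R(w,w',u,v)=g(R(w,w')u,v)$. The Weyl tensor $W$ acts on 2-forms by $2(W\zeta)_{jk}=W_{jklp}\zeta^{lp}$, and $2\langle\zeta,\eta\rangle=\zeta_{jk}\eta^{jk}$ for 2-forms. If $M$ is oriented, the Hodge star is an involution on 2-forms with $\pm1$-eigenbundles $\Lambda^\pm M$, and $W^\pm$ denotes the restriction of $W$ to $\Lambda^\pm M$. A traceless endomorphism of a 3-dimensional pseudo-Euclidean space is *of Petrov type III* if it is self-adjoint and sends some ordered basis $(\mathbf x,\mathbf y,\mathbf z)$ to $(0,\mathbf x,\mathbf y)$. An oriented $(M,g)$ is *self-dual of Petrov type III* if $W^-=0$ and $W^+$ is of Petrov type III at every point. **Strictly non-Walker.** Let $(M,g)$ be an oriented self-dual Einstein four-manifold of neutral signature and of Petrov type III. Then $\Lambda^+M$ has a global trivialization $(\zeta,\eta,\theta)$, unique up to an overall sign, with $W^+\zeta=0$, $W^+\eta=-\zeta$, $W^+\theta=\eta$, $\langle\zeta,\theta\rangle=2=-\langle\eta,\eta\rangle$ and $\langle\zeta,\zeta\rangle=\langle\zeta,\eta\rangle=\langle\eta,\theta\rangle=\langle\theta,\theta\rangle=0$; moreover $\nabla\zeta=2\alpha\otimes\zeta+2\beta\otimes\eta$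 for unique 1-forms $\alpha,\beta$. $(M,g)$ is *strictly non-Walker* if $\beta\neq0$ everywhere. **Two-plane systems.** A two-plane system $(\Sigma,\xi,\tau,\Pi,c,\Omega)$ consists of a real affine plane $\Sigma$, a real vector space $\Pi$ with $\dim\Pi=2$, two linearly independent constant 1-forms $\xi,\tau$ on $\Sigma$, a vector $c\in\Pi\smallsetminus\{0\}$, and $\Omega\in[\Pi^*]^{\wedge2}\smallsetminus\{0\}$. $\Pi_+$ is the open half-plane in $\Pi$ on which $\Omega(\cdot,c)>0$; $X$ is the radial vector field on $\Pi$ (the identity map $\Pi\to\Pi$ viewed as a vector field); $\phi=\Omega(X,c):\Pi_+\to(0,\infty)$; $Y_w=\xi(w)X+\tau(w)c$ for vectors $w$ tangent to $\Sigma$. $[\Pi^*]^{\odot2}$ is the space of symmetric bilinear forms on $\Pi$. Objects on the factors of $\Sigma\times\Pi_+$ are also treated as objects on the product. $y^1,y^2$ are affine coordinates on $\Sigma$ with $dy^1=\xi$, $dy^2=\tau$; subscripts $1,2$ on functions on $\Sigma$ denote partial derivatives with respect to $y^1,y^2$. **Construction of $\tilde g$.** For $(q,\lambda,\mu)$ as in the claim there are unique functions $s,r:\Sigma\to\mathbb R$ with $$\lambda_1(c,X)+2\Omega(X,q_2)=4\mu(q,X)+\Omega(X,a)-\phi\,\mathrm{det}_\Omega\lambda-s\phi,\qquad K\Omega(q_1,c)+s_2=2K\lambda(c,q)+8r,$$ where $\det_\Omega\lambda$ is the ratio $\det\lambda/\det\Omega$ of the determinants of the two bilinear forms in any basis of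 $\Pi$. Put $f=r\phi^3+\frac14[\lambda(c,X)-\mu(X,X)-\Omega(q,c)]\phi$, and, for vectors $w$ tangent to $\Sigma$, let $Fw=F^Kw+F^qw+F^\lambda w+F^\mu w-2f\phi^{-2}Y_w$ (a vector tangent to the $\Pi_+$ factor), where $$F^Kw=\tfrac12K\phi\,\tau(w)X,\quad F^qw=2\xi(w)q-\Omega(q,c)\phi^{-1}Y_w,$$ $$F^\lambda w=\phi^{-1}[\xi(w)\lambda(X,X)c+\tau(w)\lambda(c,c)X],\quad F^\mu w=\phi^{-1}[\mu(X,X)Y_w-2\mu(Y_w,X)X].$$ Let $\mathcal V$ be the distribution on $\Sigma\times\Pi_+$ tangent to the $\Pi_+$ factor and $\tilde{\mathcal H}$ the distribution formed by all vectors $w+Fw$, with $w$ tangent to the $\Sigma$ factor. Then $\tilde g$ is the unique metric for which both $\mathcal V$ and $\tilde{\mathcal H}$ are null and $\tilde g(v,w)=\Omega(Y_w,v)$ whenever $v$ is tangent to $\Pi_+$ and $w$ is tangent to $\Sigma$. *)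

(* Defs.v *)
From HB Require Import structures.
From mathcomp Require Import all_boot all_order all_algebra.
From mathcomp Require Import all_classical all_reals all_analysis.
From mathcomp Require Import ring.
Set Implicit Arguments.
Unset Strict Implicit.
Unset Printing Implicit Defensive.
Import Order.TTheory GRing.Theory Num.Theory.
Import numFieldNormedType.Exports.
Local Open Scope classical_set_scope.
Local Open Scope ring_scope.

(* A four-manifold covered by one chart is given by its image U, a connected  *)
(* open subset of R^4, and tensor fields by their components there, as        *)
(* functions on R^4 of which only the values on U matter.                     *)

Section Smooth.
Variable R : realType.
Local Notation pt := 'rV[R]_4.

Definition partial (i : 'I_4) (f : pt -> R) : pt -> R :=
  fun x => 'D_(delta_mx 0 i) f x.

Fixpoint Ck (n : nat) (U : set pt) (f : pt -> R) : Prop :=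
  (forall x, U x -> {for x, continuous f}) /\
  match n with
  | 0%N => True
  | n'.+1 => forall i : 'I_4,
      (forall x, U x -> derivable f x (delta_mx 0 i)) /\ Ck n' U (partial i f)
  end.

Definition smooth_on (U : set pt) (f : pt -> R) : Prop := forall n, Ck n U f.

Definition smooth_map_on (U : set pt) (F : pt -> pt) : Prop :=
  forall j, smooth_on U (fun x => F x 0 j).

Definition smooth_mx_on m n (U : set pt) (A : pt -> 'M[R]_(m, n)) : Prop :=
  forall i j, smooth_on U (fun x => A x i j).

Definition smooth_line (f : R -> R) : Prop :=
  forall n x, derivable (derive1n n f) x 1.

End Smooth.

Section Pointwise.
Variable R : realType.
Implicit Types (A Z : 'M[R]_4) (o : bool).

Definition neutral_signature A : Prop :=
  A^T = A /\
  exists2 P : 'M[R]_4, P \in unitmx &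
    P *m A *m P^T = diag_mx (\row_(i < 4) (if (i < 2)%N then -1 else 1)).

(* A is the Gram matrix of the metric, Z the matrix (Z_jk) of a 2-form;       *)
(* raise2 A Z is the matrix (Z^jk).                                           *)
Definition raise2 A Z : 'M[R]_4 := invmx A *m Z *m (invmx A)^T.

Definition ip2 A Z (Z' : 'M[R]_4) : R :=
  2^-1 * \sum_(j < 4) \sum_(k < 4) Z j k * raise2 A Z' j k.

Definition levi_symbol (j k l p : 'I_4) : R :=
  \det (\matrix_(r < 4, s < 4) (tnth [tuple j; k; l; p] r == s)%:R).

(* The orientation o = false is the one of the standard basis of R^4.         *)
Definition vol_form A o (j k l p : 'I_4) : R :=
  (-1) ^+ o * Num.sqrt `|\det A| * levi_symbol j k l p.

Definition hodge A o Z : 'M[R]_4 :=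
  \matrix_(j < 4, k < 4)
    (2^-1 * \sum_(l < 4) \sum_(p < 4) vol_form A o j k l p * raise2 A Z l p).

Lemma raise2_is_linear A : linear (raise2 A).
Proof. by move=> t Z Z'; rewrite /raise2 mulmxDr mulmxDl -scalemxAr -scalemxAl. Qed.
HB.instance Definition _ A :=
  GRing.isLinear.Build R 'M[R]_4 'M[R]_4 *:%R (raise2 A) (raise2_is_linear A).

Lemma hodge_is_linear A o : linear (hodge A o).
Proof.
move=> t Z Z'; apply/matrixP => j k; rewrite !mxE linearP /= mulrCA -mulrDr.
congr (_ * _); rewrite mulr_sumr -big_split /=; apply: eq_bigr => l _.
rewrite mulr_sumr -big_split /=; apply: eq_bigr => p _.
by rewrite mxE [in LHS]mxE mulrDr mulrCA.
Qed.
HB.instance Definition _ A o :=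
  GRing.isLinear.Build R 'M[R]_4 'M[R]_4 *:%R (hodge A o) (hodge_is_linear A o).

(* Two-forms as the kernel of Z |-> Z + Z^T; the (-1)^sg-eigenspace of the    *)
(* Hodge star, so that sg = false is Lambda^+ and sg = true is Lambda^-.      *)
Definition two_forms : {vspace 'M[R]_4} := lker (\1 + linfun trmx)%VF.

Definition Lambda A o (sg : bool) : {vspace 'M[R]_4} :=
  (two_forms :&: lker (linfun (hodge A o) - (-1) ^+ sg *: \1)%VF)%VS.

Lemma mem_Lambda A o sg Z :
  (Z \in Lambda A o sg) = (Z^T == - Z) && (hodge A o Z == (-1) ^+ sg *: Z).
Proof.
rewrite memv_cap !memv_ker !lfun_simp /= subr_eq0; congr (_ && _).
by rewrite addrC addr_eq0.
Qed.

End Pointwise.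

Section Curvature.
Variable R : realType.
Local Notation pt := 'rV[R]_4.
Variable g : pt -> 'M[R]_4.

Definition gdn (j k : 'I_4) (x : pt) : R := g x j k.
Definition gup (j k : 'I_4) (x : pt) : R := invmx (g x) j k.

(* christoffel k i j = Gamma^k_ij *)
Definition christoffel (k i j : 'I_4) (x : pt) : R :=
  2^-1 * \sum_(l < 4) gup k l x *
    (partial i (gdn j l) x + partial j (gdn i l) x - partial l (gdn i j) x).

(* R(d_i, d_j) d_k = \sum_p riem_up i j k p * d_p, with the sign convention   *)
(* R(u,v)w = nabla_v nabla_u w - nabla_u nabla_v w + nabla_[u,v] w.           *)
Definition riem_up (i j k p : 'I_4) (x : pt) : R :=
  partial j (christoffel p i k) x - partial i (christoffel p j k) x
  + \sum_(m < 4) (christoffel p j m x * christoffel m i k x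
                  - christoffel p i m x * christoffel m j k x).

Definition riem (i j k l : 'I_4) (x : pt) : R :=
  \sum_(p < 4) riem_up i j k p x * gdn p l x.

(* Ric(u,w) is the trace of v |-> R(u,v)w, which with the above sign of R is  *)
(* positive on round spheres.                                                 *)
Definition ricci (x : pt) : 'M[R]_4 :=
  \matrix_(i < 4, k < 4) \sum_(v < 4) riem_up i v k v x.

Definition scal (x : pt) : R :=
  \sum_(i < 4) \sum_(k < 4) gup i k x * ricci x i k.

Definition weyl (j k l p : 'I_4) (x : pt) : R :=
  riem j k l p x
  - 2^-1 * (gdn j l x * ricci x k p + gdn k p x * ricci x j l
            - gdn k l x * ricci x j p - gdn j p x * ricci x k l)
  + scal x / 6 * (gdn j l x * gdn k p x - gdn k l x * gdn j p x).

Definition weyl_op (x : pt) (Z : 'M[R]_4) : 'M[R]_4 :=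
  \matrix_(j < 4, k < 4)
    (2^-1 * \sum_(l < 4) \sum_(p < 4) weyl j k l p x * raise2 (g x) Z l p).

Definition nabla_form (Z : pt -> 'M[R]_4) (i : 'I_4) (x : pt) : 'M[R]_4 :=
  \matrix_(j < 4, k < 4)
    (partial i (fun z => Z z j k) x
     - \sum_(l < 4) (christoffel l i j x * Z x l k
                     + christoffel l i k x * Z x j l)).

Variable U : set pt.

Definition neutral_manifold : Prop :=
  [/\ open U, connected U, U !=set0, smooth_mx_on U g
    & forall x, U x -> neutral_signature (g x)].

Definition einstein : Prop :=
  forall x, U x -> ricci x = (scal x / 4) *: g x.

(* Tracelessness of W^+ is part of the third clause: the matrix of the        *)
(* restriction in the basis (X, Y, Z) is strictly triangular.                 *)
Definition petrov_III_at (o : bool) (x : pt) : Prop :=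
  let L := Lambda (g x) o false in
  [/\ forall Z, Z \in L -> weyl_op x Z \in L,
      forall Z Z', Z \in L -> Z' \in L ->
        ip2 (g x) (weyl_op x Z) Z' = ip2 (g x) Z (weyl_op x Z')
    & exists X Y Z, basis_of L [:: X; Y; Z] /\
        [/\ weyl_op x X = 0, weyl_op x Y = X & weyl_op x Z = Y]].

Definition self_dual (o : bool) : Prop :=
  forall x, U x -> forall Z, Z \in Lambda (g x) o true -> weyl_op x Z = 0.

Definition self_dual_petrov_III (o : bool) : Prop :=
  self_dual o /\ forall x, U x -> petrov_III_at o x.

Definition normal_frame (o : bool) (zeta eta theta : pt -> 'M[R]_4) : Prop :=
  [/\ smooth_mx_on U zeta, smooth_mx_on U eta, smooth_mx_on U theta
    & forall x, U x ->
      let ip := ip2 (g x) in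
      [/\ basis_of (Lambda (g x) o false) [:: zeta x; eta x; theta x],
          [/\ weyl_op x (zeta x) = 0, weyl_op x (eta x) = - zeta x
            & weyl_op x (theta x) = eta x],
          ip (zeta x) (theta x) = 2, ip (eta x) (eta x) = - 2
        & [/\ ip (zeta x) (zeta x) = 0, ip (zeta x) (eta x) = 0,
              ip (eta x) (theta x) = 0 & ip (theta x) (theta x) = 0]]].

Definition strictly_non_walker (o : bool) : Prop :=
  exists (zeta eta theta : pt -> 'M[R]_4) (alpha beta : pt -> 'rV[R]_4),
    [/\ normal_frame o zeta eta theta,
        smooth_mx_on U alpha, smooth_mx_on U beta,
        forall x, U x -> forall i, nabla_form zeta i x =
          (2 * alpha x 0 i) *: zeta x + (2 * beta x 0 i) *: eta x
      & forall x, U x -> beta x != 0].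

(* Row i of diff_mx F x is the image of d_i under the differential of F.      *)
Definition diff_mx (F : pt -> pt) (x : pt) : 'M[R]_4 :=
  \matrix_(i < 4, j < 4) partial i (fun z => F z 0 j) x.

(* F : V -> V' is an isometry between open submanifolds, with inverse H.      *)
Definition isometry (V V' : set pt) (F H : pt -> pt) : Prop :=
  [/\ smooth_map_on V F, smooth_map_on V' H,
      (forall x, V x -> V' (F x) /\ H (F x) = x),
      (forall x, V' x -> V (H x) /\ F (H x) = x)
    & forall x, V x -> diff_mx F x *m g (F x) *m (diff_mx F x)^T = g x].

Definition locally_homogeneous : Prop :=
  forall x x', U x -> U x' -> exists (V V' : set pt) (F H : pt -> pt),
    [/\ open V, V `<=` U & V x] /\ [/\ open V', V' `<=` U & V' x'] /\
    isometry V V' F H /\ F x = x'.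

End Curvature.

Definition symmetric_bilinear (R : realType) (V : lmodType R)
    (b : V -> V -> R) : Prop :=
  (forall u, scalar (b u)) /\ (forall u v, b u v = b v u).

Record affine_plane (R : realType) := AffinePlane {
  point :> Type;
  direction : vectType R;
  translate : point -> direction -> point;
  displacement : point -> point -> direction;
  translateD : forall p v w, translate (translate p v) w = translate p (v + w);
  translateK : forall p v, displacement (translate p v) p = v;
  displacementK : forall p p', translate p (displacement p' p) = p';
  point_inhabited : inhabited point;
  dim_direction : \dim {:direction} = 2
}.

Record two_plane_system (R : realType) := TwoPlaneSystem {
  Sigma : affine_plane R;
  xi : 'Hom(direction Sigma, R^o);
  tau : 'Hom(direction Sigma, R^o);
  Pi : vectType R;
  cvec : Pi;
  Omega : Pi -> Pi -> R;
  xi_tau_free : free [:: xi; tau];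
  dim_Pi : \dim {:Pi} = 2;
  cvec_neq0 : cvec != 0;
  Omega_scalar : forall u, scalar (Omega u);
  Omega_antisym : forall u v, Omega u v = - Omega v u;
  Omega_neq0 : exists u v, Omega u v != 0
}.

(* Affine coordinates y^1, y^2 with dy^1 = xi, dy^2 = tau; they are fixed   *)
(* by the point where both vanish, (d1, d2) being dual to (xi, tau).          *)
Record affine_coords (R : realType) (S : two_plane_system R) := AffineCoords {
  origin : Sigma S;
  d1 : direction (Sigma S);
  d2 : direction (Sigma S);
  xi_d1 : xi S d1 = 1;
  tau_d1 : tau S d1 = 0;
  xi_d2 : xi S d2 = 0;
  tau_d2 : tau S d2 = 1
}.

Section TwoPlane.
Variables (R : realType) (S : two_plane_system R).
Local Notation Sg := (Sigma S).
Local Notation dSg := (direction (Sigma S)).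
Local Notation P := (Pi S).
Local Notation xi := (xi S : dSg -> R).
Local Notation tau := (tau S : dSg -> R).
Local Notation c := (cvec S).
Local Notation Om := (@Omega R S).

Definition phi (X : P) : R := Om X c.

Definition Yvec (X : P) (w : dSg) : P := xi w *: X + tau w *: c.

(* By det_OmegaE below, the ratio does not depend on the basis.               *)
Definition gram_det (b : P -> P -> R) : R :=
  \det (\matrix_(i < \dim {:P}, j < \dim {:P})
          b (vbasis {:P})`_i (vbasis {:P})`_j).
Definition det_Omega (b : P -> P -> R) : R := gram_det b / gram_det Om.

Lemma gram_det_pair (b : P -> P -> R) (u v : P) (N : 'M[R]_(2, \dim {:P})) :
  (forall w, scalar (b w)) -> (forall w, scalar (b^~ w)) ->
  u = \sum_i N 0 i *: (vbasis {:P})`_i -> v = \sum_i N 1 i *: (vbasis {:P})`_i ->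
  b u u * b v v - b u v * b v u =
  (\sum_i \sum_j (N 0 i * N 1 j - N 0 j * N 1 i) * ((i < j)%N)%:R) ^+ 2
  * gram_det b.
Proof.
move=> bl br; rewrite /gram_det.
move: N (vbasis {:P} : seq P); rewrite dim_Pi => N e.
rewrite !big_ord_recl !big_ord0 /= !addr0 => -> ->.
have bE (x1 x2 z1 z2 : R) (p1 p2 : P) : b (x1 *: p1 + x2 *: p2) (z1 *: p1 + z2 *: p2)
   = x1 * (z1 * b p1 p1 + z2 * b p1 p2) + x2 * (z1 * b p2 p1 + z2 * b p2 p2).
  have s0 (f : P -> R) : scalar f -> forall t t' w w',
      f (t *: w + t' *: w') = t * f w + t' * f w'.
    move=> fs t t' w w'; rewrite fs; congr (_ + _).
    have f0 : f 0 = 0.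
      by have := fs 1 0 0; rewrite scaler0 addr0 mul1r => /eqP;
         rewrite -subr_eq0 opprD addNKr oppr_eq0 => /eqP.
    by have := fs t' w' 0; rewrite addr0 f0 addr0.
  by rewrite (s0 (b^~ _) (br _)) !(s0 (b _) (bl _)).
rewrite !bE (expand_det_row _ ord0) !big_ord_recl !big_ord0 /cofactor !det_mx11 !mxE /=.
rewrite /bump /= !addn0 !add0n ?expr0 ?expr1.
by ring.
Qed.

Lemma Omega_scalarl (v : P) : scalar (Om^~ v).
Proof.
move=> t u w; rewrite !(Omega_antisym _ v) Omega_scalar.
by rewrite opprD mulrN.
Qed.

Lemma det_OmegaE (b : P -> P -> R) (u v : P) :
  symmetric_bilinear b -> Om u v != 0 ->
  det_Omega b =
  (b u u * b v v - b u v * b v u) / (Om u u * Om v v - Om u v * Om v u).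
Proof.
move=> [bl bC] uv0.
have br w : scalar (b^~ w) by move=> t x z; rewrite !(bC _ w) bl.
pose N : 'M[R]_(2, \dim {:P}) := \matrix_(i, j)
  coord (vbasis {:P}) j (if i == 0 then u else v).
have NE (w : P) : w = \sum_j coord (vbasis {:P}) j w *: (vbasis {:P})`_j.
  exact: coord_vbasis (memvf w).
have uE : u = \sum_j N 0 j *: (vbasis {:P})`_j.
  by rewrite {1}(NE u); apply: eq_bigr => j _; rewrite mxE.
have vE : v = \sum_j N 1 j *: (vbasis {:P})`_j.
  by rewrite {1}(NE v); apply: eq_bigr => j _; rewrite mxE.
rewrite (gram_det_pair bl br uE vE).
have OmE := gram_det_pair (@Omega_scalar _ S) Omega_scalarl uE vE.
have : Om u u * Om v v - Om u v * Om v u != 0.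
  have Om0 w : Om w w = 0.
    have /eqP := Omega_antisym w w.
    by rewrite -addr_eq0 -mulr2n mulrn_eq0 => /eqP.
  by rewrite !Om0 mulr0 sub0r oppr_eq0 (Omega_antisym v) mulrN oppr_eq0 mulf_neq0.
rewrite OmE mulf_eq0 negb_or => /andP[D0 _].
by rewrite /det_Omega -mulf_div divff ?mul1r.
Qed.

Section Construction.
Variables (K : R) (q : Sg -> P) (lam mu : Sg -> P -> P -> R).

Definition Ffun (r : Sg -> R) (p : Sg) (X : P) : R :=
  r p * phi X ^+ 3 + 4^-1 * (lam p c X - mu p X X - Om (q p) c) * phi X.

Definition FK (X : P) (w : dSg) : P := (2^-1 * K * phi X * tau w) *: X.

Definition Fq (p : Sg) (X : P) (w : dSg) : P :=
  (2 * xi w) *: q p - (Om (q p) c / phi X) *: Yvec X w.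

Definition Flam (p : Sg) (X : P) (w : dSg) : P :=
  (phi X)^-1 *: ((xi w * lam p X X) *: c + (tau w * lam p c c) *: X).

Definition Fmu (p : Sg) (X : P) (w : dSg) : P :=
  (phi X)^-1 *: (mu p X X *: Yvec X w - (2 * mu p (Yvec X w) X) *: X).

Definition Ftot (r : Sg -> R) (p : Sg) (X : P) (w : dSg) : P :=
  FK X w + Fq p X w + Flam p X w + Fmu p X w
  - (2 * Ffun r p X / phi X ^+ 2) *: Yvec X w.

(* Vectors tangent to Sigma x Pi_+ at any point are pairs in dSg * P.         *)
Definition is_gtilde (r : Sg -> R)
    (gt : Sg * P -> dSg * P -> dSg * P -> R) : Prop :=
  forall (p : Sg) (X : P), 0 < phi X ->
    [/\ symmetric_bilinear (gt (p, X)),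
        forall v v' : P, gt (p, X) (0, v) (0, v') = 0,
        forall w w' : dSg,
          gt (p, X) (w, Ftot r p X w) (w', Ftot r p X w') = 0
      & forall (v : P) (w : dSg), gt (p, X) (0, v) (w, 0) = Om (Yvec X w) v].

Lemma is_gtilde_unique r gt gt' : is_gtilde r gt -> is_gtilde r gt' ->
  forall p X, 0 < phi X -> gt (p, X) =2 gt' (p, X).
Proof.
suff H gt0 : is_gtilde r gt0 -> forall p X, 0 < phi X ->
    forall w u w' u', gt0 (p, X) (w, u) (w', u') =
      Om (Yvec X w) (u' - Ftot r p X w') + Om (Yvec X w') (u - Ftot r p X w).
  by move=> h h' p X Xpos [w u] [w' u']; rewrite !H.
move=> /[swap] p /[swap] X h Xpos w u w' u'.
have [[gl gC] gV gH gM] := h p X Xpos.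
have gD z x x' : gt0 (p, X) z (x + x') = gt0 (p, X) z x + gt0 (p, X) z x'.
  by have := gl z 1 x x'; rewrite scale1r mul1r.
have gDl z x x' : gt0 (p, X) (x + x') z = gt0 (p, X) x z + gt0 (p, X) x' z.
  by rewrite !(gC _ z) gD.
have dec w0 u0 : (w0, u0) = (w0, Ftot r p X w0) + (0, u0 - Ftot r p X w0).
  by congr (_, _); rewrite /= ?addr0 // addrC subrK.
have gM' v w0 : gt0 (p, X) (0, v) (w0, Ftot r p X w0) = Om (Yvec X w0) v.
  have -> : (w0, Ftot r p X w0) = (w0, 0) + (0, Ftot r p X w0) :> dSg * P.
    by congr (_, _); rewrite /= ?addr0 ?add0r.
  by rewrite gD gV addr0 gM.
rewrite (dec w u) (dec w' u') gDl !gD gH gV add0r addr0 gM'.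
by rewrite (gC (w, _)) gM'.
Qed.

Variables (y : affine_coords S) (a : P).

Definition y1 (p : Sg) : R := xi (displacement p (origin y)).
Definition y2 (p : Sg) : R := tau (displacement p (origin y)).

Definition dy1 (f : Sg -> R) (p : Sg) : R :=
  derive1 (fun t : R => f (translate p (t *: d1 y))) 0.
Definition dy2 (f : Sg -> R) (p : Sg) : R :=
  derive1 (fun t : R => f (translate p (t *: d2 y))) 0.

(* The derivatives lam_1, q_1, q_2 of vector-valued functions are paired with *)
(* constant vectors before differentiating.                                   *)
Definition sr_equations (s r : Sg -> R) : Prop :=
  (forall (p : Sg) (X : P),
     dy1 (fun p' => lam p' c X) p + 2 * dy2 (fun p' => Om X (q p')) p
     = 4 * mu p (q p) X + Om X a - phi X * det_Omega (lam p) - s p * phi X) /\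
  (forall p : Sg,
     K * dy1 (fun p' => Om (q p') c) p + dy2 s p
     = 2 * K * lam p c (q p) + 8 * r p).

Lemma sr_equations_unique (s r s' r' : Sg -> R) : Om a c = 1 ->
  sr_equations s r -> sr_equations s' r' -> s = s' /\ r = r'.
Proof.
move=> ac [h1 h2] [h1' h2'].
have ss : s = s'.
  apply/funext => p; have := h1 p a; rewrite h1' /phi ac !mulr1.
  by move/addrI/oppr_inj.
split=> //; apply/funext => p; have := h2 p; rewrite ss h2' => /addrI.
by move/(mulfI _) => -> //; rewrite pnatr_eq0.
Qed.

(* The chart R^4 -> Sigma x Pi with coordinates y^1, y^2 and the components   *)
(* relative to the basis (c, a) of Pi; chart_lin is its differential.         *)
Definition chart_lin (x : 'rV[R]_4) : dSg * P :=
  (x 0 0 *: d1 y + x 0 1 *: d2 y, x 0 2%:R *: c + x 0 3%:R *: a).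
Definition chart (x : 'rV[R]_4) : Sg * P :=
  (translate (origin y) (chart_lin x).1, (chart_lin x).2).

Definition chart_dom : set 'rV[R]_4 := [set x | 0 < phi (chart x).2].

Definition chart_metric (gt : Sg * P -> dSg * P -> dSg * P -> R)
    (x : 'rV[R]_4) : 'M[R]_4 :=
  \matrix_(i < 4, j < 4)
    gt (chart x) (chart_lin (delta_mx 0 i)) (chart_lin (delta_mx 0 j)).

End Construction.
End TwoPlane.

(* Main.v *)
(* Let (y1, y2, u, v) be the coordinates with X = u c + v a, so that phi = v,   *)
(* and put Q = lambda(X, X) and E = K v^2 + 2 lambda(c, c). For q = mu = 0 one  *)
(* gets r = 0, and the metric has the components                                *)
(*    g_11 = - 2 Q, g_22 = E, g_1u = v, g_1v = - u, g_2v = - 1,                 *)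
(* the others being 0. Its curvature tensor is that of a space of constant      *)
(* curvature K plus (zeta (x) eta + eta (x) zeta) / 2, where zeta is the        *)
(* 2-form 2 v^-1 dy1 /\ dy2 and eta another self-dual 2-form; this gives the    *)
(* Einstein equation, the vanishing of W^- and the Petrov type, and beta turns  *)
(* out to be v^-2 dy1. An isometry preserves W, hence also W o W, which sends a *)
(* 2-form Y to - <zeta, Y> zeta / 2; so it preserves the pair (zeta, eta) up to *)
(* a locally constant sign, and therefore preserves alpha. Since                *)
(*    g(alpha, alpha) = - 2 K - 2 lambda(c, c) / v^2                            *)
(* is not constant, the metric is not locally homogeneous.                      *)
Require Import Defs.
From HB Require Import structures.
From mathcomp Require Import all_boot all_order all_algebra.
From mathcomp Require Import all_classical all_reals all_analysis.
From mathcomp Require Import ring lra.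
Set Implicit Arguments.
Unset Strict Implicit.
Unset Printing Implicit Defensive.
Import Order.TTheory GRing.Theory Num.Theory.
Import numFieldNormedType.Exports.
Local Open Scope classical_set_scope.
Local Open Scope ring_scope.

(** * Differential calculus on open subsets of R^4 *)

(** The theorem splits into an explicit computation and an invariance argument. With q = mu = 0 and
    m = lambda(a, c), the equation for s reads - u + v m' = - u - v det lambda - s v. The slope - 1
    of lambda(c, c) in y1 is what makes the terms in u agree, so s is a function of y1 alone and the
    other equation gives r = 0 ([sr_equations_hold]). The conditions on the metric force the formula
    [gt_of], in which f cancels, and [chart_metricE] reads off its components.

    These components lie in a class of expressions in the coordinates, 1/v and two functions of y1
    that is closed under differentiation ([derive_eval]), so every local claim becomes a rational
    identity. The central one is [riem_upE]: the curvature is a constant curvature part plus half of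
    zeta (x) eta + eta (x) zeta. Both forms are self-dual, with <zeta, zeta> = <zeta, eta> = 0 and
    <eta, eta> = - 2. The second part is therefore trace-free, which gives the Einstein equation
    ([ricciE], [scalE]). It is also the Weyl tensor ([weylE]): it kills anti-self-dual forms and
    sends - zeta, eta, theta to 0, - zeta, eta. Finally [nabla_zeta] exhibits a beta without zeros.

    For the last claim, an isometry carries Christoffel symbols to Christoffel symbols
    ([dmxA_gamma]), hence curvature to curvature ([curv_pull]) and the symmetric product of zeta and
    eta to itself. This product determines the pair up to a common sign ([frame_unique]), which is
    locally constant ([frame_pull_near]). The sign drops out of the equation for the covariant
    derivative of zeta, so alpha is preserved ([alpha_pull]), and [alpha_norm] is a non-constant
    scalar invariant. *)

Section Calculus.
Variable R : realType.
Local Notation pt := 'rV[R]_4.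
Local Notation e_ i := (delta_mx 0 i : pt).
Implicit Types (U V : set pt) (f : pt -> R) (x h : pt) (i j : 'I_4).

Lemma partial_eq U f (f' : pt -> R) i x : open U -> U x ->
  (forall z, U z -> f z = f' z) -> partial i f x = partial i f' x.
Proof.
move=> oU Ux ff'; apply: near_eq_derive.
by apply: filterS (open_nbhs_nbhs (conj oU Ux)) => z /ff'.
Qed.

Lemma is_derive_line f x (v : pt) (t : R) : derivable f (x + t *: v) v ->
  is_derive t (1 : R) (fun s : R => f (x + s *: v)) ('D_v f (x + t *: v)).
Proof.
move=> df; have E : (fun h : R => h^-1 *: (f (x + (h *: 1 + t) *: v) - f (x + t *: v)))
   = (fun h : R => h^-1 *: (f (h *: v + (x + t *: v)) - f (x + t *: v))).
  by apply/funext => h; rewrite -[h *: 1]/(h * 1) mulr1 scalerDl addrCA.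
split; first by rewrite /derivable /= E.
by rewrite /derive /= E.
Qed.

(** The mean value theorem along a line for either sign of [t]. The intermediate point is located
    only by its absolute value, which suffices for estimates in a ball. *)
Lemma mvt_line f x (v : pt) (t : R) :
  (forall s : R, `|s| <= `|t| -> derivable f (x + s *: v) v) ->
  exists2 s, `|s| <= `|t| & f (x + t *: v) - f x = t * 'D_v f (x + s *: v).
Proof.
move=> df.
have D (s : R) : `|s| <= `|t| ->
    is_derive (s : R) (1 : R) (fun s : R => f (x + s *: v)) ('D_v f (x + s *: v)).
  by move=> /df /is_derive_line.
have C (a b : R) : (forall s, s \in `[a, b] -> `|s| <= `|t|) ->
    {within `[a, b], continuous (fun s => f (x + s *: v))}.
  by move=> ab; apply: derivable_within_continuous => s /ab /D [].
have [t0|t0] := leP 0 t.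
  have I s : s \in `[0, t] -> `|s| <= `|t|.
    by rewrite in_itv /= => /andP[s0 st]; rewrite !ger0_norm.
  have [s0 [I1 E]] : exists s, s \in `[0, t] /\
      f (x + t *: v) - f x = t * 'D_v f (x + s *: v).
    have [s sI] := @MVT_segment _ (fun s => f (x + s *: v)) (fun s => 'D_v f (x + s *: v))
         0 t t0 (fun s si => D s (I s (subset_itv_oo_cc si))) (C _ _ I).
    by rewrite scale0r addr0 subr0 mulrC; exists s.
  by exists s0 => //; exact: I.
have I s : s \in `[t, 0] -> `|s| <= `|t|.
  by rewrite in_itv /= => /andP[s0 st]; rewrite !ler0_norm ?lerN2 // ltW.
have [s sI] := @MVT_segment _ (fun s => f (x + s *: v)) (fun s => 'D_v f (x + s *: v))
     t 0 (ltW t0) (fun s si => D s (I s (subset_itv_oo_cc si))) (C _ _ I).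
rewrite scale0r addr0 sub0r mulrN => E; exists s; first exact: I.
by apply: oppr_inj; rewrite opprB E mulrC.
Qed.

Lemma norm_coord x (i : 'I_4) : `|x 0 i| <= `|x|.
Proof. by rewrite [leRHS]/Num.Def.normr/= mx_normrE; exact: (le_bigmax _ _ (0, i)). Qed.

Lemma norm_row_le x (r : R) : 0 <= r -> (forall i, `|x 0 i| <= r) -> `|x| <= r.
Proof.
move=> r0 xr; rewrite [leLHS]/Num.Def.normr/= mx_normrE bigmax_le // => -[j i] _ /=.
by rewrite ord1.
Qed.

Definition head_part (k : nat) h : pt := \row_i (if (i < k)%N then h 0 i else 0).

Lemma head_partS (k : 'I_4) h : head_part k.+1 h = head_part k h + h 0 k *: e_ k.
Proof.
apply/rowP => i; rewrite !mxE ltnS eqxx /= [(i == k)](_ : _ = (nat_of_ord i == k)) //.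
by case: ltngtP => [||/val_inj->] /=; rewrite ?mulr0 ?mulr1 ?addr0 ?add0r.
Qed.

Lemma head_part4 h : head_part 4 h = h.
Proof. by apply/rowP => i; rewrite !mxE ltn_ord. Qed.

Lemma head_part0 h : head_part 0 h = 0.
Proof. by apply/rowP => i; rewrite !mxE. Qed.

Lemma norm_head_part k h (t : R) (i : 'I_4) : (i = k :> nat) -> `|t| <= `|h 0 i| ->
  `|head_part k h + t *: e_ i| <= `|h|.
Proof.
move=> ik th; apply: norm_row_le => // j; rewrite !mxE eqxx /=.
rewrite [(j == i)](_ : _ = (nat_of_ord j == i)) // -ik.
case: ltngtP => _ /=; rewrite ?mulr0 ?addr0 ?add0r ?mulr1 ?normr0 //.
  exact: norm_coord.
exact: le_trans th (norm_coord _ _).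
Qed.

(** Going from [x] to [x + h] one coordinate at a time, each step is controlled by the mean value
    theorem. The intermediate points stay in the ball of radius [|h|] about [x], where the partial
    derivatives are close to their values at [x]. *)
Lemma C1_increment U f x : open U -> U x -> Ck 1 U f ->
  forall e : R, 0 < e -> \forall h \near (0 : pt),
   `|f (x + h) - f x - \sum_i h 0 i * partial i f x| <= e * `|h|.
Proof.
move=> oU Ux [cf df] e e0.
(* Each of the four coordinate steps may contribute an error of e/4. *)
have e40 : 0 < e / 4 by rewrite divr_gt0.
have N : \forall z \near x, U z /\ forall i, `|partial i f z - partial i f x| <= e / 4.
  near=> z; split; first by near: z; exact: open_nbhs_nbhs.
  near: z; apply: (filter_forall (nbhs_filter x)) => i.
  have [_ [ci _]] := df i.
  have /cvgrPdist_le /(_ _ e40) := ci x Ux.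
  by apply: filterS => z; rewrite distrC.
move/nbhs_ballP : N => [r /= r0 Nr].
near=> h.
have hr : `|h| < r.
  by near: h; apply/nbhs_ballP; exists r => //= z; rewrite -ball_normE /= sub0r normrN.
have inb z : `|z| <= `|h| ->
    U (x + z) /\ forall i, `|partial i f (x + z) - partial i f x| <= e / 4.
  by move=> zh; apply: Nr; rewrite -ball_normE /= opprD addNKr normrN (le_lt_trans zh).
have step (i : 'I_4) : `|f (x + head_part i.+1 h) - f (x + head_part i h)
     - h 0 i * partial i f x| <= `|h| * (e / 4).
  rewrite head_partS addrA.
  have dline (s : R) : `|s| <= `|h 0 i| ->
      derivable f (x + head_part i h + s *: e_ i) (e_ i).
    move=> sh; rewrite -addrA; have [di _] := df i; apply: di.
    by have [] := inb _ (norm_head_part (k := i) erefl sh).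
  have [s sh ->] := mvt_line dline.
  rewrite -addrA -mulrBr normrM; apply: ler_pM => //; first exact: norm_coord.
  by have [_] := inb _ (norm_head_part (k := i) erefl sh); exact.
have T : f (x + h) - f x = \sum_(i < 4) (f (x + head_part i.+1 h) - f (x + head_part i h)).
  rewrite -(big_mkord xpredT (fun i : nat => f (x + head_part i.+1 h) - f (x + head_part i h))).
  by rewrite telescope_sumr // head_part4 head_part0 addr0.
rewrite T -sumrB (le_trans (ler_norm_sum _ _ _)) //.
apply: (@le_trans _ _ (\sum_(i < 4) `|h| * (e / 4))); first by apply: ler_sum => i _.
by rewrite sumr_const card_ord -[leLHS]mulr_natl; lra.
Unshelve. all: by end_near. Qed.

(** [Ck] speaks of partial derivatives only, whereas the chain rule needs a differential. *)
Lemma C1_is_diff U f x : open U -> U x -> Ck 1 U f ->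
  differentiable f x /\ forall h, 'd f x h = \sum_i h 0 i * partial i f x.
Proof.
move=> oU Ux Cf; pose L h := \sum_i h 0 i * partial i f x : R.
have Llin : linear L.
  move=> t h h'; rewrite /L scaler_sumr -big_split; apply: eq_bigr => i _ /=.
  by rewrite !mxE mulrDl scalerAl.
pose LM := GRing.isLinear.Build _ _ _ _ _ Llin.
pose LL : {linear pt -> R} := HB.pack L LM.
have cL : continuous LL.
  move=> z; apply: (@differentiable_continuous _ _ _ z (LL : pt -> R)).
  have -> : (LL : pt -> R) = \sum_i ((fun h => h 0 i) * cst (partial i f x)).
    by apply/funext => h; rewrite fct_sumE.
  apply: differentiable_sum => i; apply: differentiableM => //.
  exact: differentiable_coord.
have E : f \o shift x = cst (f x) + LL +o_ (0 : pt) id.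
  apply/eqaddoP => e e0; apply: filterS (C1_increment oU Ux Cf e0) => h /=.
  by rewrite -[(_ - _) h]/(f (h + x) - (f x + L h)) opprD addrA (addrC h).
have dE := diff_unique cL E; split; last by move=> h; rewrite dE.
by apply/diff_locallyP; rewrite dE; split.
Qed.

Lemma derive_line (W : normedModType R) (f : pt -> W) x v :
  'D_v f x = 'D_1 (fun t : R => f (t *: v + x)) 0.
Proof.
rewrite /derive; set g1 := fun t => t^-1 *: _; set g2 := fun t => t^-1 *: _.
suff -> : g1 = g2 by [].
by apply/funext => t; rewrite /g1 /g2 /= addr0 scale0r add0r -[t *: 1]/(t * 1) mulr1.
Qed.

Lemma partial_comp U V f (F : pt -> pt) x i : open U -> open V -> V x -> U (F x) ->
  Ck 1 U f -> (forall a, derivable (fun z => F z 0 a) x (e_ i)) ->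
  is_derive x (e_ i) (fun z => f (F z))
    (\sum_a partial i (fun z => F z 0 a) x * partial a f (F x)).
Proof.
move=> oU oV Vx UFx Cf dF; have [df dfE] := C1_is_diff oU UFx Cf.
have dFx : derivable F x (e_ i).
  by apply/derivable_mxP => j a; rewrite ord1.
pose h (t : R) := F (t *: e_ i + x).
have dh1 : derivable h 0 1 by exact: (iffLR (derivable1P F x (e_ i)) dFx).
have dh : differentiable h 0 by exact: (iffLR (derivable1_diffP h 0) dh1).
have h0 : h 0 = F x by rewrite /h scale0r add0r.
have dfh : differentiable (f \o h) 0 by apply: differentiable_comp => //; rewrite h0.
have dfh1 : derivable (f \o h) 0 1 by exact: (iffRL (derivable1_diffP (f \o h) 0) dfh).
split; first exact: (iffRL (derivable1P (fun z => f (F z)) x (e_ i)) dfh1).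
transitivity ('D_1 (f \o h) 0).
  exact: derive_line.
rewrite deriveE // diff_comp ?h0 //= dfE; apply: eq_bigr => a _; congr (_ * _).
rewrite -deriveE // derive_mx //.
by rewrite mxE /partial derive_line.
Qed.

End Calculus.

(** * Symmetry of second partial derivatives *)

Section Schwarz.
Variable R : realType.
Local Notation pt := 'rV[R]_4.
Local Notation e_ i := (delta_mx 0 i : pt).
Implicit Types (U V : set pt) (f : pt -> R) (x h : pt) (i j : 'I_4).

Lemma is_derive_translate f x v w : derivable f (x + w) v ->
  is_derive x v (fun z => f (z + w)) ('D_v f (x + w)).
Proof.
move=> df; have E : (fun t : R => t^-1 *: (f (t *: v + x + w) - f (x + w)))
   = (fun t : R => t^-1 *: (f (t *: v + (x + w)) - f (x + w))).
  by apply/funext => h; rewrite addrA.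
by split; rewrite /derivable /derive /= E.
Qed.

(** The second difference is the increment along [e_ i] of [p z = f (z + t *: e_ j) - f z]. The mean
    value theorem, used once in each direction, extracts the two factors [t]. *)
Lemma second_difference f x i j (t r : R) : 0 <= t -> t + t < r ->
  (forall z, `|z| < r -> derivable f (x + z) (e_ i)) ->
  (forall z, `|z| < r -> derivable (partial i f) (x + z) (e_ j)) ->
  exists2 z, `|z| < r &
    f (x + t *: e_ i + t *: e_ j) - f (x + t *: e_ i) - (f (x + t *: e_ j) - f x)
    = t * (t * partial j (partial i f) (x + z)).
Proof.
move=> t0 tr di dij.
have nz (s s' : R) : `|s| <= `|t| -> `|s'| <= `|t| -> `|s *: e_ i + s' *: e_ j| < r.
  move=> st s't; apply: le_lt_trans tr; rewrite (le_trans (ler_normD _ _)) // !normrZ.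
  have ne k : `|e_ k| <= 1.
    apply: norm_row_le => // l; rewrite mxE eqxx /=; case: eqP => _; by rewrite ?normr1 ?normr0.
  rewrite (ger0_norm t0) in st s't; apply: lerD.
    by rewrite -[leRHS]mulr1; apply: ler_pM.
  by rewrite -[leRHS]mulr1; apply: ler_pM.
pose p z := f (z + t *: e_ j) - f z.
have dp (s : R) : `|s| <= `|t| -> is_derive (x + s *: e_ i) (e_ i) p
   (partial i f (x + s *: e_ i + t *: e_ j) - partial i f (x + s *: e_ i)).
  move=> st; apply: is_deriveB.
    by apply: is_derive_translate; rewrite -addrA; apply: di; apply: nz.
  apply: derivableP; apply: di; have := nz s 0 st; rewrite scale0r addr0 normr0; apply.
  exact: normr_ge0.
have dp' (s : R) : `|s| <= `|t| -> derivable p (x + s *: e_ i) (e_ i).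
  by move=> /dp [].
have [s st] := mvt_line dp'.
rewrite (@derive_val _ _ _ _ _ _ _ (dp s st)).
have dq (s' : R) : `|s'| <= `|t| -> derivable (partial i f) (x + s *: e_ i + s' *: e_ j) (e_ j).
  by move=> s't; rewrite -addrA; apply: dij; apply: nz.
have [s' s't E] := mvt_line dq.
rewrite {}E -[x + _ + s' *: _]addrA => E.
by exists (s *: e_ i + s' *: e_ j); [exact: nz|exact: E].
Qed.

Lemma second_quotient_eq (t a b p1 p2 p3 p4 : R) : t != 0 ->
  p1 - p2 - (p3 - p4) = t * (t * a) -> p1 - p3 - (p2 - p4) = t * (t * b) -> a = b.
Proof.
move=> tn Ea Eb; apply: (mulfI tn); apply: (mulfI tn); rewrite -Ea -Eb.
by ring.
Qed.

Lemma ler_dist_half (p a b e : R) :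
  `|p - a| <= e / 2 -> `|p - b| <= e / 2 -> `|a - b| <= e.
Proof.
move=> pa pb; rewrite -(subrKA p) (splitr e) (le_trans (ler_normD _ _)) //.
by rewrite lerD // distrC.
Qed.

(** The second difference over a parallelogram is symmetric in [i] and [j], so the two mixed
    derivatives agree when taken at suitable points near [x]. Continuity at [x] then compares their
    values there. *)
Lemma partialC U f x i j : open U -> U x -> Ck 2 U f ->
  partial i (partial j f) x = partial j (partial i f) x.
Proof.
move=> oU Ux [_ C2f]; apply/eqP; rewrite -subr_eq0 -normr_le0; apply/ler_addgt0Pr => e e0.
rewrite add0r; have e20 : 0 < e / 2 by rewrite divr_gt0.
have [di [_ Cij]] := C2f i; have [dj [_ Cji]] := C2f j.
have [dij [cij _]] := Cij j; have [dji [cji _]] := Cji i.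
have N : \forall z \near x, [/\ U z,
    `|partial j (partial i f) z - partial j (partial i f) x| <= e / 2 &
    `|partial i (partial j f) z - partial i (partial j f) x| <= e / 2].
  have n1 := open_nbhs_nbhs (conj oU Ux).
  have /cvgrPdist_le /(_ _ e20) n2 := cij x Ux.
  have /cvgrPdist_le /(_ _ e20) n3 := cji x Ux.
  apply: (filterS3 (nbhs_filter x) _ n1 n2 n3) => z u1 u2 u3.
  by split; [exact: u1|rewrite distrC; exact: u2|rewrite distrC; exact: u3].
move/nbhs_ballP : N => [r /= r0 Nr].
have B z : `|z| < r -> [/\ U (x + z),
    `|partial j (partial i f) (x + z) - partial j (partial i f) x| <= e / 2 &
    `|partial i (partial j f) (x + z) - partial i (partial j f) x| <= e / 2].
  by move=> zr; apply: Nr; rewrite -ball_normE /= opprD addNKr normrN.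
(* The parallelogram with sides of length [t] has to fit into the ball of radius [r]. *)
pose t := r / 4; have t0 : 0 < t by rewrite divr_gt0.
have tr : t + t < r by rewrite /t; lra.
have [z zr E] := second_difference (ltW t0) tr
  (fun z zr => di _ (let: And3 u _ _ := B z zr in u))
  (fun z zr => dij _ (let: And3 u _ _ := B z zr in u)).
have [z' zr' E'] := second_difference (ltW t0) tr
  (fun z zr => dj _ (let: And3 u _ _ := B z zr in u))
  (fun z zr => dji _ (let: And3 u _ _ := B z zr in u)).
have EE : partial j (partial i f) (x + z) = partial i (partial j f) (x + z').
  move: E'; rewrite [x + t *: e_ j + t *: e_ i]addrAC.
  exact: (second_quotient_eq (lt0r_neq0 t0) E).
have [_ b1 _] := B z zr; have [_ _ b2] := B z' zr'.
move: b1; rewrite EE => b1; exact: (ler_dist_half b2 b1).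
Qed.

End Schwarz.

(** * Smooth functions given by expressions *)

Notation o0 := (@Ordinal 4 0 isT).
Notation o1 := (@Ordinal 4 1 isT).
Notation o2 := (@Ordinal 4 2 isT).
Notation o3 := (@Ordinal 4 3 isT).

Lemma ord4P (P : 'I_4 -> Prop) : P o0 -> P o1 -> P o2 -> P o3 -> forall i, P i.
Proof.
move=> P0 P1 P2 P3 [m lt_m4].
by case: m lt_m4 => [|[|[|[|m]]]] lt_m4 //; rewrite (bool_irrelevance lt_m4 isT).
Qed.

Lemma sum4 (V : nmodType) (F : 'I_4 -> V) :
  \sum_i F i = F o0 + (F o1 + (F o2 + F o3)).
Proof.
rewrite !big_ord_recl big_ord0 addr0.
by do !congr (_ + _); congr F; apply/val_inj.
Qed.

Section SmoothExpressions.
Variables (R : realType) (fam : bool -> R -> R).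
Hypothesis fam_smooth : forall b, smooth_line (fam b).
Local Notation pt := 'rV[R]_4.
Local Notation e_ i := (delta_mx 0 i : pt).

Definition halfspace : set pt := [set x | 0 < x 0 o3].

(** Syntax for a class of functions that contains the components of the metric, its inverse, the
    connection and the frame, and is closed under partial derivatives. [Inv3] is 1/v, and [Fun b n]
    is the n-th derivative of one of two functions of y1. *)
Inductive expr :=
  | Cst of R | Var of 'I_4 | Inv3 | Fun of bool & nat
  | Add of expr & expr | Mul of expr & expr | Opp of expr.

Fixpoint eval (t : expr) (x : pt) : R :=
  match t with
  | Cst c => c
  | Var i => x 0 i
  | Inv3 => (x 0 o3)^-1
  | Fun b n => derive1n n (fam b) (x 0 o0)
  | Add t1 t2 => eval t1 x + eval t2 x
  | Mul t1 t2 => eval t1 x * eval t2 x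
  | Opp t1 => - eval t1 x
  end.

Fixpoint diff_expr (i : 'I_4) (t : expr) : expr :=
  match t with
  | Cst c => Cst 0
  | Var j => Cst (i == j :> nat)%:R
  | Inv3 => if i == o3 :> nat then Opp (Mul Inv3 Inv3) else Cst 0
  | Fun b n => if i == o0 :> nat then Fun b n.+1 else Cst 0
  | Add t1 t2 => Add (diff_expr i t1) (diff_expr i t2)
  | Mul t1 t2 => Add (Mul t1 (diff_expr i t2)) (Mul t2 (diff_expr i t1))
  | Opp t1 => Opp (diff_expr i t1)
  end.

Lemma halfspace_open : open halfspace.
Proof.
have -> : halfspace = (fun x : pt => x 0 o3) @^-1` [set t | 0 < t] by [].
by apply: open_comp; [move=> x _; exact: coord_continuous|exact: open_gt].
Qed.

Lemma is_derive_coord (x v : pt) j : is_derive x v (fun z : pt => z 0 j) (v 0 j).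
Proof.
have dj := differentiable_coord x 0 j.
split; first exact: diff_derivable.
rewrite derive_line (_ : (fun t : R => _) = (fun t => t * v 0 j + x 0 j)); last first.
  by apply/funext => t; rewrite !mxE.
have D : is_derive (0 : R) (1 : R) (fun t => t * v 0 j + x 0 j) (v 0 j).
  apply: is_derive_eq; rewrite /= addr0.
  by rewrite -[X in _ + X]/(v 0 j * 1) mulr1 -[X in X + _]/(0 * 0) mulr0 add0r.
exact: derive_val.
Qed.

Lemma differentiable_eval t x : halfspace x -> differentiable (eval t) x.
Proof.
move=> x3; elim: t => [c|j||b n|t1 IH1 t2 IH2|t1 IH1 t2 IH2|t1 IH1].
- exact: differentiable_cst.
- exact: differentiable_coord.
- apply: (@differentiableV _ _ (fun z : pt => z 0 o3)); last by rewrite gt_eqF.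
  exact: differentiable_coord.
- apply: (@differentiable_comp _ _ _ _ (fun z : pt => z 0 o0) (derive1n n (fam b))).
    exact: differentiable_coord.
  by apply/derivable1_diffP/fam_smooth.
- exact: (differentiableD IH1 IH2).
- exact: (differentiableM IH1 IH2).
- exact: (differentiableN IH1).
Qed.

(** The syntactic derivative is the analytic one; positivity of the last coordinate enters through
    [Inv3]. *)
Lemma derive_eval t x i : halfspace x ->
  partial i (eval t) x = eval (diff_expr i t) x.
Proof.
move=> x3; rewrite /partial.
have dc v j : 'D_v (fun z : pt => z 0 j) x = v 0 j.
  exact: (@derive_val _ _ _ _ _ _ _ (is_derive_coord x v j)).
have drv t' : derivable (eval t') x (e_ i).
  exact/diff_derivable/differentiable_eval.
elim: t => [c|j||b n|t1 IH1 t2 IH2|t1 IH1 t2 IH2|t1 IH1].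
- exact: derive_cst.
- by rewrite dc mxE eqxx /= eq_sym.
- have x3n : x 0 o3 != 0 by rewrite gt_eqF.
  have d3 : derivable (fun z : pt => z 0 o3) x (e_ i) := drv (Var o3).
  rewrite (deriveV x3n d3) dc mxE eqxx /= eq_sym -[(i == o3)]/(i == o3 :> nat).
  case: (i == o3 :> nat); last by rewrite scaler0.
  by rewrite /= -[LHS]/(_ * 1) mulr1 -exprVn expr2.
- pose c0 (z : pt) := z 0 o0; pose f := derive1n n (fam b).
  have d0 : differentiable c0 x by exact: differentiable_coord.
  have df : differentiable f (c0 x) by apply/derivable1_diffP/fam_smooth.
  rewrite -[LHS]/('D_(e_ i) (f \o c0) x) deriveE; last exact: differentiable_comp.
  have d0E : 'd c0 x (e_ i) = (e_ i) 0 o0 by rewrite -deriveE //; exact: dc.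
  rewrite diff_comp //= d0E diff1E // mxE eqxx /= eq_sym.
  rewrite -[(i == o0)]/(i == o0 :> nat).
  case: (i == o0 :> nat); last by rewrite scale0r.
  by rewrite scale1r.
- by rewrite (deriveD (drv t1) (drv t2)) IH1 IH2.
- by rewrite (deriveM (drv t1) (drv t2)) IH1 IH2.
- by rewrite (deriveN (drv t1)) IH1.
Qed.

Lemma near_continuous (f f' : pt -> R) x : {near x, f =1 f'} ->
  {for x, continuous f} -> {for x, continuous f'}.
Proof.
move=> nf cf; have E := nbhs_singleton nf.
have cf' : f' @ x --> f x.
  exact: cvg_trans (@near_eq_cvg _ _ (nbhs x) (nbhs_filter x) f f' nf) cf.
by rewrite E in cf'.
Qed.

Lemma Ck_eq n U (f f' : pt -> R) : open U -> (forall x, U x -> f x = f' x) ->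
  Ck n U f -> Ck n U f'.
Proof.
move=> oU; elim: n f f' => [|n IH] f f' ff' [cf df].
  split=> // x Ux; apply: near_continuous (cf x Ux).
  by apply: filterS (open_nbhs_nbhs (conj oU Ux)) => z /ff'.
have nf x : U x -> {near x, f =1 f'}.
  by move=> Ux; apply: filterS (open_nbhs_nbhs (conj oU Ux)) => z /ff'.
split=> [x Ux|i]; first exact: near_continuous (nf x Ux) (cf x Ux).
have [di Ci] := df i; split=> [x Ux|]; first exact: near_eq_derivable (nf x Ux) (di x Ux).
by apply: IH Ci => x Ux; exact: partial_eq oU Ux ff'.
Qed.

(** Partial derivatives of expressions are again expressions, and all of them are differentiable, so
    induction on the order applies. *)
Lemma eval_smooth t : smooth_on halfspace (eval t).
Proof.
move=> n; elim: n t => [|n IH] t; split=> //.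
- by move=> x /(differentiable_eval t) /differentiable_continuous.
- by move=> x /(differentiable_eval t) /differentiable_continuous.
move=> i; split=> [x /(differentiable_eval t) /diff_derivable//|].
apply: Ck_eq halfspace_open _ (IH (diff_expr i t)) => x x3.
by rewrite derive_eval.
Qed.

Lemma partial_eval (f : pt -> R) t x i : halfspace x ->
  (forall z, halfspace z -> f z = eval t z) ->
  partial i f x = eval (diff_expr i t) x.
Proof.
move=> x3 ft; rewrite -derive_eval //; exact: partial_eq halfspace_open x3 ft.
Qed.

End SmoothExpressions.

Arguments halfspace {R}.

(** * Hodge star and inner product of 2-forms *)

Section Determinant.
Variable F : comNzRingType.

Lemma det_fun2 (f : nat -> nat -> F) :
  \det (\matrix_(i < 2, j < 2) f i j) = f 0 0 * f 1 1 - f 0 1 * f 1 0.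
Proof.
rewrite (expand_det_row _ ord0) !big_ord_recl !big_ord0 /cofactor !det_mx11 !mxE /=.
by rewrite /bump /=; ring.
Qed.

(** Laplace expansion with entries read at numerals, so that simplification can evaluate them. *)
Definition expand3 (f : nat -> nat -> F) : F :=
  f 0 0 * (f 1 1 * f 2 2 - f 1 2 * f 2 1)
  - f 0 1 * (f 1 0 * f 2 2 - f 1 2 * f 2 0)
  + f 0 2 * (f 1 0 * f 2 1 - f 1 1 * f 2 0).

Lemma det_fun3 (f : nat -> nat -> F) :
  \det (\matrix_(i < 3, j < 3) f i j) = expand3 f.
Proof.
rewrite (expand_det_row _ ord0) !big_ord_recl !big_ord0 /cofactor !mxE /=.
have E (j : 'I_3) : row' ord0 (col' j (\matrix_(i < 3, j < 3) f i j)) =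
    \matrix_(i < 2, l < 2) f i.+1 (bump j l).
  by apply/matrixP => a b; rewrite !mxE.
rewrite !E !(det_fun2 (fun i l => f i.+1 (bump _ l))) /expand3 /bump /=.
by ring.
Qed.

Definition expand4 (f : nat -> nat -> F) : F :=
  f 0 0 * expand3 (fun i l => f i.+1 (bump 0 l))
  - f 0 1 * expand3 (fun i l => f i.+1 (bump 1 l))
  + f 0 2 * expand3 (fun i l => f i.+1 (bump 2 l))
  - f 0 3 * expand3 (fun i l => f i.+1 (bump 3 l)).

Lemma det_fun4 (f : nat -> nat -> F) :
  \det (\matrix_(i < 4, j < 4) f i j) = expand4 f.
Proof.
rewrite (expand_det_row _ ord0) !big_ord_recl !big_ord0 /cofactor !mxE /=.
have E (j : 'I_4) : row' ord0 (col' j (\matrix_(i < 4, j < 4) f i j)) =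
    \matrix_(i < 3, l < 3) f i.+1 (bump j l).
  by apply/matrixP => a b; rewrite !mxE.
rewrite !E !(det_fun3 (fun i l => f i.+1 (bump _ l))) /expand4 /=.
by move: (expand3 _) (expand3 _) (expand3 _) (expand3 _) => t0 t1 t2 t3; ring.
Qed.

End Determinant.

Section Hodge.
Variable R : realType.
Implicit Types (A Z M : 'M[R]_4).

(** The contraction of the Levi-Civita symbol with [M], by [levi_sum]. For skew [M] each
    off-diagonal entry is, up to sign, twice the complementary entry of [M]. *)
Definition swap_dual M : 'M[R]_4 := \matrix_(i, j)
  match nat_of_ord i, nat_of_ord j with
  | 0, 1 => M o2 o3 - M o3 o2 | 1, 0 => M o3 o2 - M o2 o3
  | 0, 2 => M o3 o1 - M o1 o3 | 2, 0 => M o1 o3 - M o3 o1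
  | 0, 3 => M o1 o2 - M o2 o1 | 3, 0 => M o2 o1 - M o1 o2
  | 1, 2 => M o0 o3 - M o3 o0 | 2, 1 => M o3 o0 - M o0 o3
  | 1, 3 => M o2 o0 - M o0 o2 | 3, 1 => M o0 o2 - M o2 o0
  | 2, 3 => M o0 o1 - M o1 o0 | 3, 2 => M o1 o0 - M o0 o1
  | _, _ => 0
  end.

Lemma levi_symbolE j l p q : levi_symbol R j l p q =
  expand4 (fun r s =>
    (nth 0 [:: nat_of_ord j; nat_of_ord l; nat_of_ord p; nat_of_ord q] r == s)%:R).
Proof.
rewrite -det_fun4 /levi_symbol; congr (\det _); apply/matrixP => r s; rewrite !mxE.
by congr (_%:R); move: r; apply: ord4P.
Qed.

Lemma levi_sum M j l :
  \sum_p \sum_q levi_symbol R j l p q * M p q = swap_dual M j l.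
Proof.
rewrite !sum4 !levi_symbolE mxE.
move: j l; do 2!apply: ord4P; rewrite /expand4 /expand3 /bump /=; ring.
Qed.

Lemma hodgeE A o Z :
  hodge A o Z = (2^-1 * ((-1) ^+ o * Num.sqrt `|\det A|)) *: swap_dual (raise2 A Z).
Proof.
apply/matrixP => j l; rewrite mxE [in RHS]mxE -levi_sum -mulrA; congr (_ * _).
rewrite mulr_sumr; apply: eq_bigr => p _; rewrite mulr_sumr; apply: eq_bigr => q _.
by rewrite /vol_form !mulrA.
Qed.

End Hodge.

(** * Inner products under congruence, and uniqueness of the pair of 2-forms *)

Section FrameAlgebra.
Variable R : realType.
Implicit Types A B G Z E Y : 'M[R]_4.

Lemma ip2_trace A Z Y : ip2 A Z Y = 2^-1 * \tr (Z *m (raise2 A Y)^T).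
Proof.
congr (_ * _); apply: eq_bigr => i _; rewrite mxE.
by apply: eq_bigr => j _; rewrite [in RHS]mxE.
Qed.

Lemma ip2_linearl A Y t s Z E :
  ip2 A (t *: Z + s *: E) Y = t * ip2 A Z Y + s * ip2 A E Y.
Proof.
by rewrite !ip2_trace mulmxDl -!scalemxAl mxtraceD !mxtraceZ; ring.
Qed.

Lemma ip2_linearr A Y t s Z E :
  ip2 A Y (t *: Z + s *: E) = t * ip2 A Y Z + s * ip2 A Y E.
Proof.
rewrite !ip2_trace.
have -> : raise2 A (t *: Z + s *: E) = t *: raise2 A Z + s *: raise2 A E.
  by rewrite /raise2 mulmxDr mulmxDl -!scalemxAr -!scalemxAl.
have -> : (t *: raise2 A Z + s *: raise2 A E)^T = t *: (raise2 A Z)^T + s *: (raise2 A E)^T.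
  by apply/matrixP => i j; rewrite !mxE.
by rewrite mulmxDr -!scalemxAr mxtraceD !mxtraceZ; ring.
Qed.

Lemma ip2_delta A Z l p : A \in unitmx ->
  ip2 A Z (A *m delta_mx l p *m A^T) = 2^-1 * Z l p.
Proof.
move=> uA; rewrite /ip2 /raise2.
rewrite !mulmxA mulVmx // mul1mx -mulmxA -trmx_mul mulVmx // trmx1 mulmx1.
congr (_ * _); rewrite (bigD1 l) //= (bigD1 p) //= mxE !eqxx mulr1.
rewrite !big1 ?addr0 // => [i /negPf il|j /negPf jp].
  by apply: big1 => j _; rewrite mxE il mulr0.
by rewrite mxE jp andbF mulr0.
Qed.

Lemma invmx_congruence B G : B \in unitmx -> G \in unitmx ->
  invmx (B *m G *m B^T) = (invmx B)^T *m invmx G *m invmx B.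
Proof.
move=> uB uG; set X := B *m G *m B^T; set Y := _ *m invmx B.
have XY : X *m Y = 1%:M.
  rewrite /X /Y !mulmxA -[_ *m B^T *m _]mulmxA -trmx_mul mulVmx // trmx1 mulmx1.
  by rewrite -[B *m G *m _]mulmxA mulmxV // mulmx1 mulmxV.
by have [uX _] := mulmx1_unit XY; rewrite -[LHS]mulmx1 -XY mulKmx.
Qed.

Lemma ip2_congruence B G Z Y : B \in unitmx -> G \in unitmx ->
  ip2 (B *m G *m B^T) (B *m Z *m B^T) (B *m Y *m B^T) = ip2 G Z Y.
Proof.
move=> uB uG; rewrite !ip2_trace /raise2 invmx_congruence //; congr (_ * _).
rewrite !trmx_mul !trmxK !mulmxA.
rewrite -[_ *m B^T *m (invmx B)^T]mulmxA -trmx_mul mulVmx // trmx1 mulmx1.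
rewrite mxtrace_mulC !mulmxA mulVmx // mul1mx.
rewrite -[_ *m B^T *m (invmx B)^T]mulmxA -trmx_mul mulVmx // trmx1 mulmx1.
by rewrite -[_ *m invmx B *m B]mulmxA mulVmx // mulmx1.
Qed.

(* Applying Y |-> <E, Y> Z + <Z, Y> E twice gives - 2 <Z, Y> Z, so this operator *)
(* determines Z up to a sign, and then E.                                      *)
Lemma frame_unique A Z E Z' E' (i0 j0 : 'I_4) : A \in unitmx ->
  (forall i j l p, Z i j * E l p + E i j * Z l p = Z' i j * E' l p + E' i j * Z' l p) ->
  [/\ ip2 A Z Z = 0, ip2 A Z E = 0, ip2 A E Z = 0 & ip2 A E E = - 2] ->
  [/\ ip2 A Z' Z' = 0, ip2 A Z' E' = 0, ip2 A E' Z' = 0 & ip2 A E' E' = - 2] ->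
  Z i0 j0 != 0 ->
  exists2 s : R, s * s = 1 & Z' = s *: Z /\ E' = s *: E.
Proof.
move=> uA ZE [zz ze ez ee] [zz' ze' ez' ee'] z0.
have W Y : ip2 A E Y *: Z + ip2 A Z Y *: E = ip2 A E' Y *: Z' + ip2 A Z' Y *: E'.
  have C (Z1 E1 : 'M[R]_4) i j : (ip2 A E1 Y *: Z1 + ip2 A Z1 Y *: E1) i j =
      2^-1 * \sum_l \sum_p (Z1 i j * E1 l p + E1 i j * Z1 l p) * raise2 A Y l p.
    rewrite !mxE /ip2 -!mulrA -mulrDr; congr (_ * _).
    rewrite !mulr_suml -big_split; apply: eq_bigr => l _ /=.
    by rewrite !mulr_suml -big_split; apply: eq_bigr => p _ /=; ring.
  apply/matrixP => i j; rewrite !C; congr (_ * _).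
  by apply: eq_bigr => l _; apply: eq_bigr => p _; rewrite ZE.
have W2 Y : ip2 A Z Y *: Z = ip2 A Z' Y *: Z'.
  have E1 := W (ip2 A E Y *: Z + ip2 A Z Y *: E).
  move: E1; rewrite [in X in _ = X](W Y) !ip2_linearr zz ze ez ee zz' ze' ez' ee'.
  rewrite !mulr0 !addr0 !add0r !scale0r !addr0 !mulrN !scaleNr => /oppr_inj.
  by rewrite !(mulrC _ 2) -!scalerA => /(scalerI _); apply; rewrite pnatr_eq0.
have ZZ l p i j : Z l p * Z i j = Z' l p * Z' i j.
  (* Pairing with this matrix reads off the entry [l p], so [W2] becomes the equality of the tensor
     squares of Z and Z'. *)
  have /matrixP/(_ i j) := W2 (A *m delta_mx l p *m A^T).
  rewrite !ip2_delta // !mxE -!mulrA => /(mulfI _); apply.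
  by rewrite invr_eq0 pnatr_eq0.
have z0' : Z' i0 j0 != 0.
  by have := mulf_neq0 z0 z0; rewrite ZZ mulf_eq0 orbb.
pose s := Z' i0 j0 / Z i0 j0.
have ss : s * s = 1 by rewrite /s mulrACA -ZZ mulrACA divff // mulr1.
have Zs : Z' = s *: Z.
  apply/matrixP => i j; rewrite mxE /s; apply: (mulfI z0').
  by rewrite -ZZ 2!mulrA -ZZ mulfK.
exists s => //; split=> //.
(* The symmetric product of Z and D vanishes. Since Z has a nonzero entry at [i0 j0], this kills
   first that entry of D and then all the others. *)
pose D := E - s *: E'.
have DZ i j l p : Z i j * D l p + D i j * Z l p = 0.
  have := ZE i j l p; rewrite Zs !mxE => H.
  have -> : Z i j * (E l p - s * E' l p) + (E i j - s * E' i j) * Z l p =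
    (Z i j * E l p + E i j * Z l p) - (s * Z i j * E' l p + E' i j * (s * Z l p)) by ring.
  by rewrite H subrr.
have D0 : D i0 j0 = 0.
  have := DZ i0 j0 i0 j0; rewrite mulrC -mulr2n => /eqP.
  by rewrite mulrn_eq0 /= mulf_eq0 (negPf z0) orbF => /eqP.
have /eqP : D = 0.
  apply/matrixP => l p; have := DZ i0 j0 l p; rewrite D0 mul0r addr0 => /eqP.
  by rewrite mulf_eq0 (negPf z0) /= => /eqP ->; rewrite mxE.
by rewrite subr_eq0 => /eqP ->; rewrite scalerA ss scale1r.
Qed.

End FrameAlgebra.

(** * Curvature of the metric in coordinates *)

Declare Scope expr_scope.
Delimit Scope expr_scope with expr.
Bind Scope expr_scope with expr.
Notation "s + t" := (Add s t) : expr_scope.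
Notation "s * t" := (Mul s t) : expr_scope.
Notation "- t" := (Opp t) : expr_scope.
Notation "s - t" := (Add s (Opp t)) : expr_scope.
Notation "'#' c" := (Cst c%R) (at level 8, format "'#' c") : expr_scope.

Section Geometry.
Variables (R : realType) (K k : R) (fam : bool -> R -> R).
Hypothesis fam_smooth : forall b, smooth_line (fam b).
Local Notation pt := 'rV[R]_4.
Local Notation ev := (eval fam).

Local Notation u := (Var _ o2).
Local Notation v := (Var _ o3).
Local Notation w := (Inv3 R).
Local Notation m := (Fun R false 0).
Local Notation n := (Fun R true 0).
Local Notation m' := (Fun R false 1).
Local Notation n' := (Fun R true 1).

(* lcc, Qx and Lx are lambda(c, c), lambda(X, X) and lambda(c, X), where       *)
(* m = lambda(a, c) and n = lambda(a, a).                                      *)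
Definition lcc : expr R := (#k - Var _ o0)%expr.
Definition Qx : expr R := (u * u * lcc + #2 * u * v * m + v * v * n)%expr.
Definition Ex : expr R := (#K * v * v + #2 * lcc)%expr.

Definition Lx : expr R := (u * lcc + v * m)%expr.

Definition metric_tab (i j : nat) : expr R :=
  match i, j with
  | 0, 0 => - #2 * Qx
  | 1, 1 => Ex
  | 0, 2 | 2, 0 => v
  | 0, 3 | 3, 0 => - u
  | 1, 3 | 3, 1 => - #1
  | _, _ => #0
  end%expr.

Definition inverse_tab (i j : nat) : expr R :=
  match i, j with
  | 0, 2 | 2, 0 => w
  | 1, 2 | 2, 1 => - u * w
  | 1, 3 | 3, 1 => - #1
  | 2, 2 => (#2 * Qx - u * u * Ex) * w * w
  | 2, 3 | 3, 2 => - u * Ex * w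
  | 3, 3 => - Ex
  | _, _ => #0
  end%expr.

Definition christoffel_tab (p i j : nat) : expr R :=
  match p, i, j with
  | 0, 0, 0 => #2 * (u * lcc * w + m)
  | 0, 0, 3 | 0, 3, 0 => w
  | 1, 0, 0 => - #2 * Qx * w
  | 1, 0, 2 | 1, 2, 0 => #1
  | 1, 0, 3 | 1, 3, 0 => - u * w
  | 1, 1, 1 => #K * v
  | 2, 0, 0 => - #2 * #K * u * Qx + #4 * m * Qx * w + u * u * w - #2 * u * m' - v * n'
  | 2, 0, 1 | 2, 1, 0 => u * w
  | 2, 0, 2 | 2, 2, 0 => #K * u * v - #2 * m
  | 2, 0, 3 | 2, 3, 0 => - #K * u * u + #2 * u * m * w
  | 2, 1, 1 => #K * u * Ex + w
  | 2, 1, 3 | 2, 3, 1 => - #K * u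
  | 3, 0, 0 => - #2 * Qx * Ex * w
  | 3, 0, 1 | 3, 1, 0 => #1
  | 3, 0, 2 | 3, 2, 0 => Ex
  | 3, 0, 3 | 3, 3, 0 => - u * Ex * w
  | 3, 1, 1 => #K * v * Ex
  | 3, 1, 3 | 3, 3, 1 => - #K * v
  | _, _, _ => #0
  end%expr.

Variable g : pt -> 'M[R]_4.
Hypothesis gE : forall x, halfspace x -> forall i j, g x i j = ev (metric_tab i j) x.

Lemma inverseE x : halfspace x -> forall i j, gup g i j x = ev (inverse_tab i j) x.
Proof.
move=> x3; have x3n : x 0 o3 != 0 by rewrite gt_eqF.
pose B : 'M[R]_4 := \matrix_(i, j) ev (inverse_tab i j) x.
have gB : g x *m B = 1%:M.
  apply/matrixP => i j; rewrite !mxE sum4 !mxE !gE //.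
  by move: i j; do 2!apply: ord4P; rewrite /=; field.
have [gu _] := mulmx1_unit gB.
have BE : invmx (g x) = B by rewrite -[LHS]mulmx1 -gB mulKmx.
by move=> i j; rewrite /gup BE mxE.
Qed.

Lemma partial_gdn x : halfspace x -> forall l i j,
  partial l (gdn g i j) x = ev (diff_expr l (metric_tab i j)) x.
Proof. by move=> x3 l i j; apply: partial_eval => // z z3; exact: gE. Qed.

Lemma christoffelE x : halfspace x -> forall p i j,
  christoffel g p i j x = ev (christoffel_tab p i j) x.
Proof.
move=> x3; have x3n : x 0 o3 != 0 by rewrite gt_eqF.
move=> p i j; rewrite /christoffel sum4 !inverseE // !partial_gdn //.
by move: p i j; do 3!apply: ord4P; rewrite /=; field.
Qed.

(** * The curvature tensor in terms of two 2-forms *)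

Definition zeta_tab (i j : nat) : expr R :=
  match i, j with
  | 0, 1 => #2 * w
  | 1, 0 => - #2 * w
  | _, _ => #0
  end%expr.

Definition eta_tab (i j : nat) : expr R :=
  match i, j with
  | 0, 1 => - Lx
  | 1, 0 => Lx
  | 0, 2 => - v
  | 2, 0 => v
  | 0, 3 => u
  | 3, 0 => - u
  | 1, 3 => #1
  | 3, 1 => - #1
  | _, _ => #0
  end%expr.

(** Mixed components: contracting the second index with g gives back [zeta_tab]. The same holds for
    [eta_up] and [eta_tab]; both facts are checked in [riemE]. *)
Definition zeta_up (i p : nat) : expr R :=
  match i, p with
  | 0, 2 => - #2 * u * w * w
  | 0, 3 => - #2 * w
  | 1, 2 => - #2 * w * w
  | _, _ => #0
  end%expr.

Definition eta_up (i p : nat) : expr R :=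
  match i, p with
  | 0, 0 | 1, 1 => - #1
  | 0, 2 => (u * Lx - #2 * Qx) * w
  | 0, 3 => Lx
  | 1, 2 => (Lx - u * Ex) * w
  | 1, 3 => - Ex
  | 2, 2 | 3, 3 => #1
  | _, _ => #0
  end%expr.

Lemma riem_upC (i j l p : 'I_4) x : riem_up g i j l p x = - riem_up g j i l p x.
Proof.
rewrite /riem_up opprD opprB -sumrN; congr (_ + _).
by apply: eq_bigr => s _; rewrite opprB.
Qed.

Lemma partial_christoffel x : halfspace x -> forall l p i j,
  partial l (christoffel g p i j) x = ev (diff_expr l (christoffel_tab p i j)) x.
Proof. by move=> x3 l p i j; apply: partial_eval => // z z3; exact: christoffelE. Qed.

Lemma riem_upE x : halfspace x -> forall i j l p,
  riem_up g i j l p x =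
    K * (gdn g i l x * (j == p)%:R - gdn g j l x * (i == p)%:R)
    + 2^-1 * (ev (zeta_tab i j) x * ev (eta_up l p) x
              + ev (eta_tab i j) x * ev (zeta_up l p) x).
Proof.
move=> x3; have x3n : x 0 o3 != 0 by rewrite gt_eqF.
(* Both sides are skew in [i] and [j], which leaves six pairs of indices for the case analysis. *)
suff H (i j l p : 'I_4) : (i < j)%N -> riem_up g i j l p x =
    K * (gdn g i l x * (j == p :> nat)%:R - gdn g j l x * (i == p :> nat)%:R)
    + 2^-1 * (ev (zeta_tab i j) x * ev (eta_up l p) x
              + ev (eta_tab i j) x * ev (zeta_up l p) x).
  have zA (i j : nat) : ev (zeta_tab i j) x = - ev (zeta_tab j i) x.
    by case: i j => [|[|i]] [|[|j]] /=; rewrite ?oppr0 ?mulNr ?opprK.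
  have eA (i j : nat) : ev (eta_tab i j) x = - ev (eta_tab j i) x.
    by case: i j => [|[|[|[|i]]]] [|[|[|[|j]]]] /=; rewrite ?oppr0 ?mulNr ?opprK.
  move=> i j l p; have [ij|ji|/val_inj->] := ltngtP i j; first exact: H.
    by rewrite riem_upC H // (zA i) (eA i); ring.
  have self0 (t : R) : t = - t -> t = 0.
    by move=> /eqP; rewrite -addr_eq0 -mulr2n mulrn_eq0 /= => /eqP.
  rewrite (self0 _ (riem_upC j j l p x)) (self0 _ (zA j j)) (self0 _ (eA j j)).
  by rewrite subrr mulr0 add0r !mul0r addr0 mulr0.
rewrite /riem_up sum4 !partial_christoffel // !christoffelE // /gdn !gE //.
by move: i j l p; do 4!apply: ord4P => //; move=> _; rewrite /=; field.
Qed.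

(** The part of the curvature built from zeta and eta is trace-free: for self-dual forms the
    symmetrized composition is a multiple of the inner product, and <zeta, eta> = 0. The constant
    curvature part contributes (4 - 1) K g. *)
Lemma ricciE x : halfspace x -> ricci g x = (3 * K) *: g x.
Proof.
move=> x3; have x3n : x 0 o3 != 0 by rewrite gt_eqF.
have RE := riem_upE x3.
apply/matrixP => i j; rewrite !mxE sum4 !RE /gdn !gE //.
by move: i j; do 2!apply: ord4P; rewrite /=; field.
Qed.

Lemma scalE x : halfspace x -> scal g x = 12 * K.
Proof.
move=> x3; have x3n : x 0 o3 != 0 by rewrite gt_eqF.
rewrite /scal !sum4 ricciE // !inverseE // !mxE !gE //=.
by field.
Qed.

Lemma riemE x : halfspace x -> forall i j l p,
  riem g i j l p x =
    K * (gdn g i l x * gdn g j p x - gdn g j l x * gdn g i p x)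
    + 2^-1 * (ev (zeta_tab i j) x * ev (eta_tab l p) x
              + ev (eta_tab i j) x * ev (zeta_tab l p) x).
Proof.
move=> x3 i j l p; have x3n : x 0 o3 != 0 by rewrite gt_eqF.
have RE := riem_upE x3.
have eE (l' p' : 'I_4) :
    ev (eta_tab l' p') x = \sum_(q < 4) ev (eta_up l' q) x * gdn g q p' x.
  rewrite sum4 /gdn !gE //.
  by move: l' p'; do 2!apply: ord4P; rewrite /=; field.
have zE (l' p' : 'I_4) :
    ev (zeta_tab l' p') x = \sum_(q < 4) ev (zeta_up l' q) x * gdn g q p' x.
  rewrite sum4 /gdn !gE //.
  by move: l' p'; do 2!apply: ord4P; rewrite /=; field.
have dE (a : 'I_4) : gdn g a p x = \sum_(q < 4) (a == q)%:R * gdn g q p x.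
  rewrite (bigD1 a) //= eqxx mul1r big1 ?addr0 // => q.
  by rewrite eq_sym => /negPf ->; rewrite mul0r.
rewrite /riem (eE l p) (zE l p) (dE i) (dE j) !sum4 !RE; ring.
Qed.

Definition tab_mx (t : nat -> nat -> expr R) (x : pt) : 'M[R]_4 :=
  \matrix_(i, j) ev (t i j) x.

(** As Ric = 3 K g and the scalar curvature is 12 K, the terms subtracted in [weyl] add up to the
    constant curvature part. *)
Lemma weylE x : halfspace x -> forall i j l p,
  weyl g i j l p x =
    2^-1 * (tab_mx zeta_tab x i j * tab_mx eta_tab x l p
            + tab_mx eta_tab x i j * tab_mx zeta_tab x l p).
Proof.
move=> x3 i j l p; rewrite /weyl riemE // scalE // ricciE // !mxE /gdn.
by field.
Qed.

Lemma weyl_opE x Z : halfspace x -> weyl_op g x Z =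
  (2^-1 * ip2 (g x) (tab_mx eta_tab x) Z) *: tab_mx zeta_tab x
  + (2^-1 * ip2 (g x) (tab_mx zeta_tab x) Z) *: tab_mx eta_tab x.
Proof.
move=> x3; apply/matrixP => i j; rewrite [LHS]mxE.
rewrite [RHS]mxE [in X in _ = X + _]mxE [in X in _ = _ + X]mxE.
rewrite /ip2 !mulrA [LHS]mulr_sumr ![_ * _ * \sum_i _]mulr_sumr.
rewrite !mulr_suml -big_split /=; apply: eq_bigr => l _.
rewrite [LHS]mulr_sumr ![_ * _ * \sum_i _]mulr_sumr !mulr_suml -big_split /=.
apply: eq_bigr => p _; rewrite weylE //.
by move: (raise2 _ _ _ _) (tab_mx _ _ _ _) => t0 t1; ring.
Qed.

(** * Inner product and Hodge star in the coordinates *)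

Lemma det_gE x : halfspace x -> \det (g x) = x 0 o3 ^+ 2.
Proof.
move=> x3.
have -> : g x = \matrix_(i < 4, j < 4) ev (metric_tab i j) x.
  by apply/matrixP => i j; rewrite mxE gE.
rewrite (det_fun4 (fun i j => ev (metric_tab i j) x)) /expand4 /expand3 /bump /=.
by ring.
Qed.

(* The components above the diagonal of [raise2 (g x) Z], for skew [Z]. *)
Definition raise_fun (x : pt) (Z : 'M[R]_4) (i j : nat) : R :=
  let q := ev Qx x in let e := ev Ex x in
  let y := x 0 o2 in let z := x 0 o3 in
  match i, j with
  | 0, 1 => - (Z o2 o3 / z)
  | 0, 2 => (y * Z o1 o2 - Z o0 o2 - y * e * Z o2 o3) / z ^+ 2
  | 0, 3 => (Z o1 o2 - e * Z o2 o3) / z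
  | 1, 2 => (y * Z o0 o2 + z * Z o0 o3 - y ^+ 2 * Z o1 o2 - y * z * Z o1 o3
             + 2 * q * Z o2 o3) / z ^+ 2
  | 1, 3 => - (y * Z o1 o2 / z) - Z o1 o3
  | 2, 3 => (2 * q * Z o1 o2 - z * Z o0 o1 - y * e * Z o0 o2 - e * z * Z o0 o3
             - 2 * q * e * Z o2 o3) / z ^+ 2
  | _, _ => 0
  end.

Lemma skew_entries (Z : 'M[R]_4) : Z^T = - Z ->
  (forall i, Z i i = 0) /\ forall i j, Z j i = - Z i j.
Proof.
move=> ZA.
have Zs i j : Z j i = - Z i j by have := congr1 (fun A : 'M[R]_4 => A i j) ZA; rewrite !mxE.
split=> // i; apply/eqP; have /eqP := Zs i i.
by rewrite -addr_eq0 -mulr2n mulrn_eq0.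
Qed.

Lemma raise2E x Z : halfspace x -> Z^T = - Z ->
  raise2 (g x) Z = \matrix_(i, j) (raise_fun x Z i j - raise_fun x Z j i).
Proof.
move=> x3 ZA; have x3n : x 0 o3 != 0 by rewrite gt_eqF.
have [Z0 Zs] := skew_entries ZA.
have giE i j : invmx (g x) i j = ev (inverse_tab i j) x := inverseE x3 i j.
apply/matrixP => i j; rewrite !mxE sum4 !mxE !sum4 !giE.
rewrite !Z0 (Zs o0 o1) (Zs o0 o2) (Zs o0 o3) (Zs o1 o2) (Zs o1 o3) (Zs o2 o3).
by move: i j; do 2!apply: ord4P; rewrite /raise_fun /=; field.
Qed.

Lemma ip2E x Z Z' : halfspace x -> Z^T = - Z -> Z'^T = - Z' ->
  ip2 (g x) Z Z' =
    Z o0 o1 * raise_fun x Z' 0 1 + Z o0 o2 * raise_fun x Z' 0 2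
    + Z o0 o3 * raise_fun x Z' 0 3 + Z o1 o2 * raise_fun x Z' 1 2
    + Z o1 o3 * raise_fun x Z' 1 3 + Z o2 o3 * raise_fun x Z' 2 3.
Proof.
move=> x3 ZA ZA'; have x3n : x 0 o3 != 0 by rewrite gt_eqF.
have [Z0 Zs] := skew_entries ZA.
rewrite /ip2 (raise2E x3 ZA') !sum4 !mxE !Z0.
rewrite (Zs o0 o1) (Zs o0 o2) (Zs o0 o3) (Zs o1 o2) (Zs o1 o3) (Zs o2 o3) /=.
set f01 := raise_fun x Z' 0 1; set f02 := raise_fun x Z' 0 2.
set f03 := raise_fun x Z' 0 3; set f12 := raise_fun x Z' 1 2.
set f13 := raise_fun x Z' 1 3; set f23 := raise_fun x Z' 2 3.
by rewrite /raise_fun; field.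
Qed.

(** * The self-dual frame, self-duality and the Petrov type *)

Local Notation zetam := (tab_mx zeta_tab).
Local Notation etam := (tab_mx eta_tab).

(** The self-dual form that completes zeta and eta to a normal frame; it is determined by <zeta,
    theta> = 2, <eta, theta> = 0 and <theta, theta> = 0. *)
Definition theta_tab (i j : nat) : expr R :=
  let h := (#(2^-1))%expr in
  let t01 := (h * v * (h * Lx * Lx - Ex * Qx))%expr in
  let t02 := (h * v * v * Lx)%expr in
  let t03 := (h * v * (#2 * Qx - u * Lx))%expr in
  let t12 := (- h * v * v * Ex)%expr in
  let t13 := (h * v * (u * Ex - Lx))%expr in
  match i, j with
  | 0, 1 => t01 | 1, 0 => - t01
  | 0, 2 => t02 | 2, 0 => - t02
  | 0, 3 => t03 | 3, 0 => - t03
  | 1, 2 => t12 | 2, 1 => - t12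
  | 1, 3 => t13 | 3, 1 => - t13
  | 2, 3 => - v * v | 3, 2 => v * v
  | _, _ => #0
  end%expr.
Local Notation thetam := (tab_mx theta_tab).

Lemma zeta_skew x : (zetam x)^T = - zetam x.
Proof. by apply/matrixP; do 2!apply: ord4P; rewrite !mxE /=; ring. Qed.

Lemma eta_skew x : (etam x)^T = - etam x.
Proof. by apply/matrixP; do 2!apply: ord4P; rewrite !mxE /=; ring. Qed.

Lemma theta_skew x : (thetam x)^T = - thetam x.
Proof. by apply/matrixP; do 2!apply: ord4P; rewrite !mxE /=; ring. Qed.

Lemma metric_sym x : halfspace x -> (g x)^T = g x.
Proof.
move=> x3; apply/matrixP => i j; rewrite mxE !gE //.
by move: i j; do 2!apply: ord4P.
Qed.

Lemma ip2_frame x : halfspace x ->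
  [/\ ip2 (g x) (zetam x) (zetam x) = 0, ip2 (g x) (zetam x) (etam x) = 0,
      ip2 (g x) (etam x) (zetam x) = 0, ip2 (g x) (etam x) (etam x) = - 2
    & [/\ ip2 (g x) (zetam x) (thetam x) = 2, ip2 (g x) (etam x) (thetam x) = 0
        & ip2 (g x) (thetam x) (thetam x) = 0]].
Proof.
move=> x3; have x3n : x 0 o3 != 0 by rewrite gt_eqF.
have [[zA eA] tA] := (zeta_skew x, eta_skew x, theta_skew x).
by split; last split; rewrite ip2E // /raise_fun !mxE /=; field.
Qed.

(** The square root of the determinant is v. The factor 1/2 is absorbed by skewness of the raised
    form, and the sign of the orientation [true] by the transposition of [f]. *)
Lemma hodge_skew x Z : halfspace x -> Z^T = - Z ->
  let f := raise_fun x Z in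
  hodge (g x) true Z = x 0 o3 *: swap_dual (\matrix_(i, j) (f j i)).
Proof.
move=> x3 ZA f; have x3n : x 0 o3 != 0 by rewrite gt_eqF.
rewrite hodgeE (raise2E x3 ZA) det_gE //.
rewrite ger0_norm ?sqr_ge0 // sqrtr_sqr gtr0_norm // expr1.
apply/matrixP => i j; rewrite !mxE /f.
by move: i j; do 2!apply: ord4P; rewrite /raise_fun /=; field.
Qed.

Lemma frame_self_dual x : halfspace x ->
  [/\ zetam x \in Lambda (g x) true false, etam x \in Lambda (g x) true false
    & thetam x \in Lambda (g x) true false].
Proof.
move=> x3; have x3n : x 0 o3 != 0 by rewrite gt_eqF.
have hz := hodge_skew x3 (zeta_skew x); have he := hodge_skew x3 (eta_skew x).
have ht := hodge_skew x3 (theta_skew x).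
split; rewrite mem_Lambda ?zeta_skew ?eta_skew ?theta_skew eqxx /= expr0 scale1r ?hz ?he ?ht;
  by apply/eqP/matrixP; do 2!apply: ord4P; rewrite !mxE /= ?mxE /raise_fun /= ?mxE /=; field.
Qed.

(** Four entries are enough: three of them cut out the self-dual forms, and the last one forces the
    entry (2, 3) of an anti-self-dual form to vanish. *)
Lemma hodge_entries x Z : halfspace x -> Z^T = - Z ->
  let H := hodge (g x) true Z in
  let: (y, z, q, e) := (x 0 o2, x 0 o3, ev Qx x, ev Ex x) in
  [/\ H o0 o2 = - (y * Z o1 o2 + z * Z o1 o3), H o1 o2 = e * Z o2 o3 - Z o1 o2,
      z * H o0 o3 = y * (y * Z o1 o2 + z * Z o1 o3 - Z o0 o2) - z * Z o0 o3 - 2 * q * Z o2 o3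
    & H o2 o3 = Z o2 o3].
Proof.
move=> x3 ZA; have x3n : x 0 o3 != 0 by rewrite gt_eqF.
by rewrite /= (hodge_skew x3 ZA) !mxE /raise_fun /=; split; field.
Qed.

Lemma Lambda_plus_entries x Z : halfspace x -> Z \in Lambda (g x) true false ->
  let: (y, z, q, e) := (x 0 o2, x 0 o3, ev Qx x, ev Ex x) in
  [/\ Z^T = - Z, Z o1 o2 = e * Z o2 o3 / 2, Z o0 o2 = - (y * Z o1 o2 + z * Z o1 o3)
    & Z o0 o3 = (y * (y * Z o1 o2 + z * Z o1 o3) - q * Z o2 o3) / z].
Proof.
move=> x3; have x3n : x 0 o3 != 0 by rewrite gt_eqF.
rewrite mem_Lambda expr0 scale1r => /andP[/eqP ZA /eqP HZ] /=.
have := hodge_entries x3 ZA; rewrite /= HZ => -[E02 E12 E03 _].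
split=> //; first by lra.
by apply: (mulfI x3n); rewrite mulrCA divff // mulr1; rewrite E02 in E03; lra.
Qed.

(** The factor [s] serves both the normal frame, with s = 1, and the Petrov basis, with s = - 1. A
    self-dual form is fixed by its entries (0, 1), (1, 3) and (2, 3), where the frame is
    triangular. *)
Lemma frame_basis (s : R) x : s != 0 -> halfspace x ->
  basis_of (Lambda (g x) true false) [:: s *: zetam x; etam x; thetam x].
Proof.
move=> s0 x3; have x3n : x 0 o3 != 0 by rewrite gt_eqF.
have [zL eL tL] := frame_self_dual x3.
rewrite /basis_of; apply/andP; split; last first.
  apply/(@freeP _ _ 3 [tuple s *: zetam x; etam x; thetam x]) => c.
  rewrite !big_ord_recl big_ord0 addr0 /= => E.
  have Eij i j : c ord0 * (s * zetam x i j) + (c (lift ord0 ord0) * etam x i j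
      + c (lift ord0 (lift ord0 ord0)) * thetam x i j) = 0.
    by have := congr1 (fun A : 'M[R]_4 => A i j) E; rewrite !mxE.
  have c2 : c (lift ord0 (lift ord0 ord0)) = 0.
    have := Eij o2 o3; rewrite !mxE /= !mulr0 !add0r => /eqP.
    by rewrite mulf_eq0 mulNr oppr_eq0 mulf_eq0 (negPf x3n) /= !orbF => /eqP.
  have c1 : c (lift ord0 ord0) = 0.
    by have := Eij o1 o3; rewrite c2 !mxE /= !mulr0 mul0r add0r addr0 mulr1.
  have c0 : c ord0 = 0.
    have := Eij o0 o1; rewrite c2 c1 !mxE /= !mul0r !addr0 => /eqP.
    rewrite !mulf_eq0 invr_eq0 (negPf x3n) (negPf s0) pnatr_eq0 /= !orbF.
    by move/eqP.
  case=> [[|[|[|i]]] ilt] //; [rewrite -[RHS]c0|rewrite -[RHS]c1|rewrite -[RHS]c2];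
    by congr (c _); exact: val_inj.
rewrite eqEsubv; apply/andP; split.
  apply/span_subvP => Z; rewrite !inE => /or3P[]/eqP-> //; exact: memvZ.
apply/subvP => Z /(Lambda_plus_entries x3) /= [ZA E12 E02 E03].
have [Z0 Zs] := skew_entries ZA.
(* Only theta has an entry at (2, 3), equal to - v^2, and zeta has none at (1, 3). The coefficients
   of theta, eta and zeta are therefore found in this order. *)
pose c := - (Z o2 o3 / x 0 o3 ^+ 2); pose b := Z o1 o3 - c * thetam x o1 o3.
pose a := (Z o0 o1 - b * etam x o0 o1 - c * thetam x o0 o1) * x 0 o3 / 2.
have -> : Z = (a / s) *: (s *: zetam x) + b *: etam x + c *: thetam x.
  rewrite scalerA divfK //; apply/matrixP => i j; rewrite !mxE /a /b /c.
  move: i j; do 2!apply: ord4P; rewrite !mxE ?Z0 ?(Zs o0 o1) ?(Zs o0 o2) ?(Zs o0 o3)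
    ?(Zs o1 o2) ?(Zs o1 o3) ?(Zs o2 o3) ?E03 ?E02 ?E12 /=; by field.
by rewrite !memvD // memvZ // memv_span // !inE eqxx ?orbT.
Qed.

Lemma weyl_op_frame x : halfspace x ->
  [/\ weyl_op g x (zetam x) = 0, weyl_op g x (etam x) = - zetam x
    & weyl_op g x (thetam x) = etam x].
Proof.
move=> x3; have [zz ze ez ee [zt et tt]] := ip2_frame x3.
rewrite !weyl_opE // zz ze ez ee zt et !mulr0 !scale0r !addr0 add0r.
by rewrite mulrN mulVf ?pnatr_eq0 // scaleN1r scale1r.
Qed.

(** By [weyl_opE] the Weyl operator sees a form only through its products with zeta and eta. These
    vanish on anti-self-dual forms, because zeta and eta are self-dual. *)
Lemma self_dual_halfspace : self_dual g halfspace true.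
Proof.
move=> x x3 Z; have x3n : x 0 o3 != 0 by rewrite gt_eqF.
rewrite mem_Lambda expr1 scaleN1r => /andP[/eqP ZA /eqP HZ].
have := hodge_entries x3 ZA; rewrite /= HZ !mxE => -[E02 _ _ E23].
have Z23 : Z o2 o3 = 0 by lra.
rewrite weyl_opE // !ip2E // ?zeta_skew ?eta_skew //.
rewrite /raise_fun Z23 !mxE /=.
rewrite [X in X *: tab_mx _ _](_ : _ = 0) ?scale0r ?add0r; last first.
  have -> : Z o0 o2 = x 0 o2 * Z o1 o2 + x 0 o3 * Z o1 o3 by lra.
  by field.
rewrite [X in X *: tab_mx _ _](_ : _ = 0) ?scale0r //.
by field.
Qed.

Lemma ip2C (A Z Z' : 'M[R]_4) : A^T = A -> ip2 A Z Z' = ip2 A Z' Z.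
Proof.
move=> AT; pose B := invmx A; have BT : B^T = B by rewrite /B trmx_inv AT.
have trE (X Y : 'M[R]_4) : \sum_(j < 4) \sum_(l < 4) X j l * Y j l = \tr (X *m Y^T).
  by apply: eq_bigr => i _; rewrite mxE; apply: eq_bigr => j _; rewrite mxE.
rewrite /ip2 !trE /raise2 -/B !trmx_mul !trmxK !BT; congr (_ * _).
rewrite -[LHS]mxtrace_tr !trmx_mul !trmxK BT.
by rewrite -!mulmxA mxtrace_mulC !mulmxA.
Qed.

Lemma petrov_III_halfspace x : halfspace x -> petrov_III_at g true x.
Proof.
move=> x3; have [zL eL tL] := frame_self_dual x3.
have WE := weyl_opE _ x3.
have gT := metric_sym x3.
have ipZ (A X Z : 'M[R]_4) t : ip2 A (t *: X) Z = t * ip2 A X Z.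
  by have := ip2_linearl A Z t 0 X X; rewrite scale0r addr0 mul0r addr0.
split.
- by move=> Z _; rewrite WE memvD ?memvZ.
- by move=> Z Z' _ _; rewrite [RHS]ip2C // !WE !ip2_linearl; ring.
exists (- 1 *: zetam x), (etam x), (thetam x); split.
  by apply: frame_basis => //; rewrite oppr_eq0 oner_eq0.
have [_ We Wt] := weyl_op_frame x3; split=> //; last by rewrite scaleN1r.
have [zz ze _ _ _] := ip2_frame x3.
by rewrite WE ip2C // ipZ ze (ip2C _ _ gT) ipZ zz !mulr0 !scale0r addr0.
Qed.

(** * The covariant derivative of zeta *)

Definition alpha_row (x : pt) : 'rV[R]_4 := \row_i
  match nat_of_ord i with
  | 0 => - (ev Lx x / (2 * x 0 o3))
  | 1 => - (K * x 0 o3 / 2)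
  | 3 => - (x 0 o3)^-1
  | _ => 0
  end.

Definition beta_row (x : pt) : 'rV[R]_4 :=
  \row_i (if nat_of_ord i == 0 then (x 0 o3 ^+ 2)^-1 else 0).

Lemma nabla_zeta x : halfspace x -> forall i, nabla_form g zetam i x =
  (2 * alpha_row x 0 i) *: zetam x + (2 * beta_row x 0 i) *: etam x.
Proof.
move=> x3 i; have x3n : x 0 o3 != 0 by rewrite gt_eqF.
have dz (j l : 'I_4) : partial i (fun z => zetam z j l) x = ev (diff_expr i (zeta_tab j l)) x.
  by apply: (partial_eval fam_smooth (t := zeta_tab j l) i x3) => z _; rewrite mxE.
apply/matrixP => j l; rewrite !mxE dz !sum4 !christoffelE // !mxE.
by move: i j l {dz}; do 3!apply: ord4P; rewrite /=; field.
Qed.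

Lemma tab_smooth t : smooth_mx_on halfspace (tab_mx t).
Proof.
move=> i j r; apply: (Ck_eq (@halfspace_open R)) (eval_smooth fam_smooth (t i j) r) => x _.
by rewrite mxE.
Qed.

Lemma row_smooth (f : pt -> 'rV[R]_4) (t : nat -> expr R) :
  (forall x (i : 'I_4), f x 0 i = ev (t i) x) -> smooth_mx_on halfspace f.
Proof.
move=> ft i j r; rewrite ord1.
by apply: (Ck_eq (@halfspace_open R)) (eval_smooth fam_smooth (t j) r) => x _.
Qed.

Lemma strictly_non_walker_halfspace : strictly_non_walker g halfspace true.
Proof.
exists zetam, etam, thetam, alpha_row, beta_row; split.
- split=> [|||x x3]; try exact: tab_smooth.
  have [zz ze _ ee [zt et tt]] := ip2_frame x3; split=> //.
    by rewrite -[zetam x]scale1r; apply: frame_basis => //; exact: oner_neq0.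
  exact: weyl_op_frame.
- apply: (@row_smooth _ (fun i => match i with
    | 0 => - #(2^-1) * Lx * w | 1 => - #(K / 2) * v | 3 => - w | _ => #0 end%expr)).
  by move=> x; apply: ord4P; rewrite mxE /= ?invfM; move: (x 0 o3)^-1 => t; field.
- apply: (@row_smooth _ (fun i => if i == 0 then (w * w)%expr else (#0)%expr)).
  by move=> x; apply: ord4P; rewrite mxE //= expr2 invfM.
- exact: nabla_zeta.
move=> x x3; apply/eqP => /rowP /(_ o0); rewrite !mxE /= => /eqP.
by rewrite invr_eq0 expf_eq0 /= gt_eqF.
Qed.

(** * Smoothness, signature and connectedness *)

Lemma metric_smooth : smooth_mx_on halfspace g.
Proof.
move=> i j r.
by apply: (Ck_eq (@halfspace_open R)) (eval_smooth fam_smooth (metric_tab i j) r) => x /gE.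
Qed.

(* A null frame adapted to the two null distributions, rotated by 45 degrees. *)
Definition signature_tab (i j : nat) : expr R :=
  let h := (#(2^-1))%expr in
  let a := ((Qx - h * u * u * Ex) * w)%expr in
  match i, j with
  | 0, 0 | 1, 1 | 2, 0 | 3, 1 => #1
  | 0, 2 => a - h * w
  | 0, 3 => - h * u * Ex
  | 1, 2 => h * u * w
  | 1, 3 => h * Ex + h
  | 2, 2 => a + h * w
  | 2, 3 => - h * u * Ex
  | 3, 2 => - h * u * w
  | 3, 3 => h * Ex - h
  | _, _ => #0
  end%expr.

Lemma neutral_signature_halfspace x : halfspace x -> neutral_signature (g x).
Proof.
move=> x3; have x3n : x 0 o3 != 0 by rewrite gt_eqF.
split; first exact: metric_sym.
set D := diag_mx _; pose P := tab_mx signature_tab x.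
have PD : P *m g x *m P^T = D.
  apply/matrixP => i j; rewrite !mxE sum4 !mxE !sum4 !gE // !mxE.
  by move: i j; do 2!apply: ord4P; rewrite /=; field.
exists P => //; rewrite unitmxE.
have : \det D != 0.
  rewrite det_diag; apply/prodf_neq0 => i _; rewrite mxE.
  by case: ifP; rewrite ?oppr_eq0 oner_neq0.
rewrite -PD !det_mulmx det_tr !mulf_eq0 !negb_or unitfE => /andP[/andP[]//].
Qed.

(** The half-space is star-shaped about the point (0, 0, 0, 1), hence a union of segments with a
    common point. *)
Lemma halfspace_connected : connected (@halfspace R).
Proof.
pose seg (x : pt) : set pt :=
  (fun t : R => delta_mx 0 o3 + t *: (x - delta_mx 0 o3)) @` `[0, 1].
have -> : @halfspace R = \bigcup_(x in halfspace) seg x.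
  apply/seteqP; split=> [x x3|_ [x x3 [t t01 <-]]].
    exists x => //; exists 1; first by rewrite /= in_itv /= ler01 lexx.
    by rewrite scale1r addrC subrK.
  move: t01 x3; rewrite /halfspace /= in_itv /= !mxE /= => /andP[t0 t1] x3.
  have [->|t_neq1] := eqVneq t 1; first by rewrite mul1r; lra.
  have t_lt1 : t < 1 by rewrite lt_neqAle t_neq1.
  have : 0 <= t * x 0 o3 by rewrite mulr_ge0 // ltW.
  by lra.
apply: bigcup_connected.
  exists (delta_mx 0 o3) => x _; exists 0; first by rewrite /= in_itv /= ler01 lexx.
  by rewrite scale0r addr0.
move=> x _; apply: connected_continuous_connected; first exact: segment_connected.
apply: continuous_subspaceT => t; apply: cvgD; first exact: cvg_cst.
exact: scalel_continuous.
Qed.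

Lemma neutral_manifold_halfspace : neutral_manifold g halfspace.
Proof.
split; [exact: halfspace_open|exact: halfspace_connected| |exact: metric_smooth|].
  by exists (delta_mx 0 o3); rewrite /halfspace /= mxE !eqxx /= ltr01.
exact: neutral_signature_halfspace.
Qed.

End Geometry.

(** * Invariance under isometries *)

(* Locked: otherwise comparing two partial derivatives unfolds the limits. *)
HB.lock Definition dmx (R : realType) (p q : nat) (i : 'I_4)
    (M : 'rV[R]_4 -> 'M[R]_(p, q)) (x : 'rV[R]_4) : 'M[R]_(p, q) :=
  \matrix_(j, l) partial i (fun z => M z j l) x.
Canonical dmx_unlockable := Unlockable dmx.unlock.

HB.lock Definition gamma (R : realType) (g : 'rV[R]_4 -> 'M[R]_4) (i : 'I_4)
    (x : 'rV[R]_4) : 'M[R]_4 :=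
  \matrix_(j, l) christoffel g l i j x.
Canonical gamma_unlockable := Unlockable gamma.unlock.

(** * Derivatives of matrix-valued functions *)

Section MatrixDerivative.
Variable R : realType.
Local Notation pt := 'rV[R]_4.
Local Notation e_ i := (delta_mx 0 i : pt).

Definition mx_derivable (p q : nat) (M : pt -> 'M[R]_(p, q)) (x : pt) : Prop :=
  forall i j l, derivable (fun z => M z j l) x (e_ i).

Lemma dmxE p q i (M : pt -> 'M[R]_(p, q)) x j l :
  dmx i M x j l = partial i (fun z => M z j l) x.
Proof. by rewrite unlock mxE. Qed.

Lemma dmx_eq p q U (M N : pt -> 'M[R]_(p, q)) i x : open U -> U x ->
  (forall z, U z -> M z = N z) -> dmx i M x = dmx i N x.
Proof.
move=> oU Ux MN; apply/matrixP => j l; rewrite !dmxE.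
by apply: (partial_eq i oU Ux) => z /MN ->.
Qed.

Lemma is_derive_sum_mul (n : nat) (f h : 'I_n -> pt -> R) (x v : pt) :
  (forall l, derivable (f l) x v) -> (forall l, derivable (h l) x v) ->
  is_derive x v (fun z => \sum_l f l z * h l z)
    (\sum_l ('D_v (f l) x * h l x + f l x * 'D_v (h l) x)).
Proof.
move=> df dh.
have -> : (fun z => \sum_l f l z * h l z) = \sum_l (f l * h l).
  by apply/funext => z; rewrite fct_sumE.
split; first by apply: derivable_sum => l; exact: derivableM.
rewrite derive_sum; last by move=> l; exact: derivableM.
apply: eq_bigr => l _; rewrite (deriveM (df l) (dh l)) addrC; congr (_ + _).
by rewrite -[LHS]/(h l x * _) mulrC.
Qed.

Lemma dmxM p q r (M : pt -> 'M[R]_(p, q)) (N : pt -> 'M[R]_(q, r)) x :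
  mx_derivable M x -> mx_derivable N x ->
  mx_derivable (fun z => M z *m N z) x /\
  forall i, dmx i (fun z => M z *m N z) x = dmx i M x *m N x + M x *m dmx i N x.
Proof.
move=> dM dN.
have E j l : (fun z => (M z *m N z) j l) = (fun z => \sum_s M z j s * N z s l).
  by apply/funext => z; rewrite mxE.
split=> [i j l|i].
  by rewrite E; have [] := is_derive_sum_mul (fun s => dM i j s) (fun s => dN i s l).
apply/matrixP => j l; rewrite dmxE E !mxE -big_split /=.
have [_ D] := is_derive_sum_mul (fun s => dM i j s) (fun s => dN i s l).
by rewrite [LHS]D; apply: eq_bigr => s _; rewrite !(dmxE, mxE).
Qed.

Lemma dmx_tr p q (M : pt -> 'M[R]_(p, q)) x :
  mx_derivable M x -> mx_derivable (fun z => (M z)^T) x /\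
  forall i, dmx i (fun z => (M z)^T) x = (dmx i M x)^T.
Proof.
move=> dM.
have E j l : (fun z => (M z)^T j l) = (fun z => M z l j).
  by apply/funext => z; rewrite mxE.
by split=> [i j l|i]; [rewrite E|apply/matrixP => j l; rewrite mxE !dmxE E].
Qed.

Lemma dmxB p q (M N : pt -> 'M[R]_(p, q)) x :
  mx_derivable M x -> mx_derivable N x -> forall i,
  dmx i (fun z => M z - N z) x = dmx i M x - dmx i N x.
Proof.
move=> dM dN i; apply/matrixP => j l; rewrite !(mxE, dmxE).
have -> : (fun z => (M z - N z) j l) = (fun z => M z j l) - (fun z => N z j l).
  by apply/funext => z; rewrite !mxE.
exact: (deriveB (dM i j l) (dN i j l)).
Qed.

Lemma dmx_scale p q t (M : pt -> 'M[R]_(p, q)) x : mx_derivable M x -> forall i,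
  dmx i (fun z => t *: M z) x = t *: dmx i M x.
Proof.
move=> dM i; apply/matrixP => j l; rewrite !(mxE, dmxE).
have -> : (fun z => (t *: M z) j l) = t *: (fun z => M z j l).
  by apply/funext => z; rewrite !mxE.
exact: (deriveZ t (dM i j l)).
Qed.

Lemma dmx_sum_scale p q (f : 'I_4 -> pt -> R) (M : 'I_4 -> pt -> 'M[R]_(p, q)) x :
  (forall i a, derivable (f a) x (e_ i)) -> (forall a, mx_derivable (M a) x) ->
  mx_derivable (fun z => \sum_a f a z *: M a z) x /\
  forall i, dmx i (fun z => \sum_a f a z *: M a z) x =
    \sum_a partial i (f a) x *: M a x + \sum_a f a x *: dmx i (M a) x.
Proof.
move=> df dM.
have E j l : (fun z => (\sum_a f a z *: M a z) j l) = (fun z => \sum_a f a z * M a z j l).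
  by apply/funext => z; rewrite summxE; apply: eq_bigr => a _; rewrite mxE.
split=> [i j l|i].
  by rewrite E; have [] := is_derive_sum_mul (df i) (fun a => dM a i j l).
apply/matrixP => j l; rewrite dmxE E mxE !summxE -big_split /=.
have [_ D] := is_derive_sum_mul (df i) (fun a => dM a i j l).
by rewrite [LHS]D; apply: eq_bigr => s _; rewrite !(dmxE, mxE).
Qed.

Lemma smooth_mx_derivable p q U (M : pt -> 'M[R]_(p, q)) x :
  smooth_mx_on U M -> U x -> mx_derivable M x.
Proof.
by move=> sM Ux i j l; have [_ /(_ i)[d _]] := sM j l 1; exact: d.
Qed.

End MatrixDerivative.

(** * The Levi-Civita connection in matrix form *)

Section LeviCivita.
Variables (R : realType) (g : 'rV[R]_4 -> 'M[R]_4).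
Local Notation pt := 'rV[R]_4.

Local Notation gamma := (gamma g).

Lemma gammaE i x j l : gamma i x j l = christoffel g l i j x.
Proof. by rewrite unlock mxE. Qed.

Definition curv (i j : 'I_4) (x : pt) : 'M[R]_4 :=
  dmx j (gamma i) x - dmx i (gamma j) x
  + (gamma i x *m gamma j x - gamma j x *m gamma i x).

Lemma curvE i j l p x : curv i j x l p = riem_up g i j l p x.
Proof.
rewrite /riem_up !(mxE, dmxE); congr (_ - _ + _).
- by congr (partial _ _ x); apply/funext => z; rewrite gammaE.
- by congr (partial _ _ x); apply/funext => z; rewrite gammaE.
rewrite -sumrB; apply: eq_bigr => s _; rewrite !gammaE.
by congr (_ - _); rewrite mulrC.
Qed.

Lemma nabla_formE Z i x :
  nabla_form g Z i x = dmx i Z x - gamma i x *m Z x - Z x *m (gamma i x)^T.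
Proof.
apply/matrixP => j l; rewrite !(mxE, dmxE) big_split /= opprD addrA; congr (_ - _ - _).
  by apply: eq_bigr => s _; rewrite gammaE.
by apply: eq_bigr => s _; rewrite mxE gammaE mulrC.
Qed.

Variable U : set pt.
Hypothesis oU : open U.
Hypothesis g_sym : forall x, U x -> (g x)^T = g x.
Hypothesis g_unit : forall x, U x -> g x \in unitmx.

Lemma partial_gdnC i j l x : U x -> partial i (gdn g j l) x = partial i (gdn g l j) x.
Proof.
move=> Ux; apply: (partial_eq i oU Ux) => z Uz; rewrite /gdn.
by rewrite -[in LHS]g_sym // mxE.
Qed.

Lemma gammaC i j l x : U x -> gamma i x j l = gamma j x i l.
Proof.
move=> Ux; rewrite !gammaE /christoffel; congr (_ * _); apply: eq_bigr => s _.
by rewrite (partial_gdnC s i j Ux) [X in X - _]addrC.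
Qed.

(** With the upper index lowered, the Christoffel symbol is half of the derivative of g_jl in
    direction i plus terms skew in j and l. Adding the transpose cancels the latter. *)
Lemma gamma_metric i x : U x -> dmx i g x = gamma i x *m g x + g x *m (gamma i x)^T.
Proof.
move=> Ux.
have low j l : (gamma i x *m g x) j l =
    2^-1 * (partial i (gdn g j l) x + partial j (gdn g i l) x - partial l (gdn g i j) x).
  pose C := \row_s
    (partial i (gdn g j s) x + partial j (gdn g i s) x - partial s (gdn g i j) x).
  have -> : (gamma i x *m g x) j l = 2^-1 * (C *m invmx (g x) *m g x) 0 l.
    rewrite !mxE mulr_sumr; apply: eq_bigr => s _; rewrite !mxE gammaE mulrA.
    congr (_ * _); rewrite /christoffel; congr (_ * _); apply: eq_bigr => t _.
    rewrite !mxE /gup mulrC; congr (_ * _).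
    by have := congr1 (fun M : 'M[R]_4 => M t s) (trmx_inv (g x)); rewrite g_sym // mxE.
  by rewrite -mulmxA mulVmx ?g_unit // mulmx1 mxE.
have -> : g x *m (gamma i x)^T = (gamma i x *m g x)^T by rewrite trmx_mul g_sym.
apply/matrixP => j l; rewrite dmxE [RHS]mxE [in X in _ = _ + X]mxE !low.
rewrite (partial_gdnC i l j Ux) -/(gdn g j l).
rewrite -[LHS]/(partial i (gdn g j l) x).
by move: (partial _ _ _) (partial _ _ _) (partial _ _ _) => t0 t1 t2; field.
Qed.

End LeviCivita.

(** Expands sums and opposites entrywise but leaves entries of products as atoms, so that [ring]
    settles identities between already distributed matrix products. *)
Lemma mx_addoppE (V : zmodType) p q (i : 'I_p) (j : 'I_q) :
  (forall X Y : 'M[V]_(p, q), (X + Y) i j = X i j + Y i j)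
  * (forall X : 'M[V]_(p, q), (- X) i j = - X i j).
Proof. by split=> *; rewrite mxE. Qed.

Section MatrixContinuity.
Variable R : realType.
Local Notation pt := 'rV[R]_4.

Definition mx_continuous (M : pt -> 'M[R]_4) (x : pt) : Prop :=
  forall i j, {for x, continuous (fun z => M z i j)}.

Lemma mx_continuousM M N x : mx_continuous M x -> mx_continuous N x ->
  mx_continuous (fun z => M z *m N z) x.
Proof.
move=> cM cN i j.
have -> : (fun z => (M z *m N z) i j) = (fun z => M z i o0 * N z o0 j
    + (M z i o1 * N z o1 j + (M z i o2 * N z o2 j + M z i o3 * N z o3 j))).
  by apply/funext => z; rewrite mxE sum4.
have cMN l : {for x, continuous (fun z => M z i l * N z l j)}.
  exact: (continuousM (cM i l) (cN l j)).
exact: (continuousD (cMN o0) (continuousD (cMN o1) (continuousD (cMN o2) (cMN o3)))).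
Qed.

Lemma mx_continuousT M x : mx_continuous M x -> mx_continuous (fun z => (M z)^T) x.
Proof.
move=> cM i j; have -> : (fun z => (M z)^T i j) = (fun z => M z j i); last exact: cM.
by apply/funext => z; rewrite mxE.
Qed.

Lemma smooth_mx_continuous U M x : smooth_mx_on U M -> U x -> mx_continuous M x.
Proof. by move=> sM Ux i j; have [c _] := sM i j 0; exact: c. Qed.

Lemma nabla_form_near (g Z Z' : pt -> 'M[R]_4) i x :
  (\forall z \near x, Z z = Z' z) -> nabla_form g Z i x = nabla_form g Z' i x.
Proof.
move=> ZZ'; rewrite !nabla_formE (nbhs_singleton ZZ'); congr (_ - _ - _).
apply/matrixP => j l; rewrite !dmxE; apply: near_eq_derive.
by apply: filterS ZZ' => z ->.
Qed.

Lemma nabla_form_scale (g Z : pt -> 'M[R]_4) t i x : mx_derivable Z x ->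
  nabla_form g (fun z => t *: Z z) i x = t *: nabla_form g Z i x.
Proof.
move=> dZ; rewrite !nabla_formE dmx_scale // -scalemxAr -scalemxAl.
by rewrite -!scalerBr.
Qed.

End MatrixContinuity.

(** * Pulling back tensors with four indices *)

Section Pull4.
Variables (R : realType) (B : 'M[R]_4).
Implicit Types (T : 'I_4 -> 'I_4 -> 'I_4 -> 'I_4 -> R) (M N : 'M[R]_4).

Definition pull4 T (i j l p : 'I_4) : R :=
  \sum_a \sum_b \sum_c \sum_d B i a * B j b * (B l c * B p d) * T a b c d.

Lemma congruenceE M i j :
  (B *m M *m B^T) i j = \sum_a \sum_b B i a * B j b * M a b.
Proof.
rewrite mxE exchange_big /=; apply: eq_bigr => b _; rewrite !mxE mulr_suml.
by apply: eq_bigr => a _; ring.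
Qed.

Lemma eq_pull4 T T' i j l p : (forall a b c d, T a b c d = T' a b c d) ->
  pull4 T i j l p = pull4 T' i j l p.
Proof. by move=> E; do 4!apply: eq_bigr => ? _; rewrite E. Qed.

Lemma pull4_linear t T s T' i j l p :
  pull4 (fun a b c d => t * T a b c d + s * T' a b c d) i j l p
  = t * pull4 T i j l p + s * pull4 T' i j l p.
Proof.
rewrite /pull4; do 4!(rewrite !mulr_sumr -big_split; apply: eq_bigr => ? _ /=).
by ring.
Qed.

(** Together with [pull4_swap23], this rearranges products such as [G a c * G b d] into the shape
    handled by [pull4_tensor]. *)
Lemma pull4_swap12 T i j l p :
  pull4 T i j l p = pull4 (fun a b => T b a) j i l p.
Proof.
rewrite /pull4 exchange_big; do 4!apply: eq_bigr => ? _ /=.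
by rewrite [B i _ * _]mulrC.
Qed.

Lemma pull4_swap23 T i j l p :
  pull4 T i j l p = pull4 (fun a b c d => T a c b d) i l j p.
Proof.
rewrite /pull4; apply: eq_bigr => a _; rewrite exchange_big.
by do 3!apply: eq_bigr => ? _ /=; rewrite mulrACA.
Qed.

Lemma pull4_tensor M N i j l p :
  pull4 (fun a b c d => M a b * N c d) i j l p
  = (B *m M *m B^T) i j * (B *m N *m B^T) l p.
Proof.
rewrite !congruenceE mulr_suml; apply: eq_bigr => a _.
rewrite mulr_suml; apply: eq_bigr => b _; rewrite mulr_sumr; apply: eq_bigr => c _.
by rewrite mulr_sumr; apply: eq_bigr => d _; ring.
Qed.

End Pull4.

(** * Naturality of the connection, the curvature and the frame *)

Section Pullback.
Variables (R : realType) (g : 'rV[R]_4 -> 'M[R]_4).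
Local Notation pt := 'rV[R]_4.

Variable U : set pt.
Hypothesis oU : open U.
Hypothesis g_sym : forall x, U x -> (g x)^T = g x.
Hypothesis g_unit : forall x, U x -> g x \in unitmx.
Hypothesis g_smooth : smooth_mx_on U g.
Hypothesis gamma_smooth : forall i, smooth_mx_on U (gamma g i).

(* A stands for the Jacobian matrix of F; it is kept abstract so that its     *)
(* entries never unfold to limits.                                            *)
Variables (V : set pt) (F : pt -> pt) (A : pt -> 'M[R]_4).
Hypothesis oV : open V.
Hypothesis VU : V `<=` U.
Hypothesis FU : forall x, V x -> U (F x).
Hypothesis A_smooth : smooth_mx_on V A.
Hypothesis A_dmxC : forall i j l x, V x -> dmx i A x j l = dmx j A x i l.
Hypothesis A_chain : forall p q (M : pt -> 'M[R]_(p, q)) x,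
  smooth_mx_on U M -> V x -> mx_derivable (fun z => M (F z)) x /\
  forall i, dmx i (fun z => M (F z)) x = \sum_a A x i a *: dmx a M (F x).
Hypothesis F_continuous : forall M x, smooth_mx_on U M -> V x ->
  mx_continuous (fun z => M (F z)) x.
Hypothesis A_metric : forall x, V x -> A x *m g (F x) *m (A x)^T = g x.

Lemma A_unit x : V x -> A x \in unitmx.
Proof.
move=> Vx; have := g_unit (VU Vx); rewrite -A_metric // -mulmxA unitmx_mul.
by case/andP.
Qed.

Lemma A_derivable x : V x -> mx_derivable A x.
Proof. exact: smooth_mx_derivable A_smooth. Qed.

Lemma dmx_dmxC i j x : V x -> dmx i (dmx j A) x = dmx j (dmx i A) x.
Proof.
move=> Vx; apply/matrixP => a b.
have E s : (fun z => dmx s A z a b) = partial s (fun z => A z a b).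
  by apply/funext => z; rewrite dmxE.
have E1 := dmxE i (dmx j A) x a b; have E2 := dmxE j (dmx i A) x a b.
rewrite E in E1; rewrite E in E2.
exact: etrans E1 (etrans (partialC i j oV Vx (A_smooth a b 2)) (esym E2)).
Qed.

(* The derivative of B G B^T = g, where D = dB and P, C are connection forms   *)
(* of G and g: it makes the defect of the connection skew.                     *)
Lemma metric_derivative_cancel (D B G C P : 'M[R]_4) : G^T = G ->
  (D *m G + B *m (P *m G + G *m P^T)) *m B^T + B *m G *m D^T =
     C *m (B *m G *m B^T) + B *m G *m B^T *m C^T ->
  (D + B *m P - C *m B) *m G *m B^T + ((D + B *m P - C *m B) *m G *m B^T)^T = 0.
Proof.
move=> GT /eqP; rewrite -subr_eq0 => /eqP E; rewrite -[RHS]E.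
rewrite !trmx_mul !trmxK GT !(raddfB, raddfD) /= !trmx_mul.
rewrite !(mulmxDl, mulmxDr, mulmxBl, mulmxBr, mulNmx, mulmxA).
apply/matrixP => i j; rewrite !mx_addoppE; ring.
Qed.

Definition pull_gamma i x := \sum_a A x i a *: gamma g a (F x).

Lemma pull_gamma_derivable x : V x -> forall i, mx_derivable (pull_gamma i) x /\
  forall j, dmx j (pull_gamma i) x = \sum_a dmx j A x i a *: gamma g a (F x)
     + \sum_a \sum_b (A x i a * A x j b) *: dmx b (gamma g a) (F x).
Proof.
move=> Vx i.
have [d E] := @dmx_sum_scale _ _ _ (fun a z => A z i a) (fun a z => gamma g a (F z)) x
  (fun j a => @A_derivable x Vx j i a)
  (fun a => (A_chain (gamma_smooth a) Vx).1).
split=> // j; rewrite [LHS]E; congr (_ + _).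
  by apply: eq_bigr => a _; rewrite dmxE.
apply: eq_bigr => a _; rewrite (A_chain (gamma_smooth a) Vx).2 scaler_sumr.
by apply: eq_bigr => b _; rewrite scalerA.
Qed.

(** Alternating the two symmetries three times restores the order of the indices with a minus sign.
    This is the algebra behind the uniqueness of the Levi-Civita connection. *)
Lemma skew_sym3 (S : 'I_4 -> 'I_4 -> 'I_4 -> R) :
  (forall i j l, S i j l = - S i l j) -> (forall i j l, S i j l = S j i l) ->
  forall i j l, S i j l = 0.
Proof.
move=> skew sym i j l; have /eqP : S i j l = - S i j l.
  by rewrite {1}skew sym skew opprK sym skew sym.
by rewrite -addr_eq0 -mulr2n mulrn_eq0 /= => /eqP.
Qed.

(** The transformation law of Christoffel symbols. The defect [N] is symmetric in its first two
    indices, since second derivatives commute and both connections are torsion-free. After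
    contraction with [G *m (A x)^T] it is skew in the last two, since both connections are metric.
    So it vanishes by [skew_sym3]. *)
Lemma dmxA_gamma i x : V x ->
  dmx i A x = gamma g i x *m A x - A x *m pull_gamma i x.
Proof.
move=> Vx; set G := g (F x).
pose N i := dmx i A x + A x *m pull_gamma i x - gamma g i x *m A x.
suff N0 : N i = 0 by apply/eqP; rewrite -subr_eq0 opprB addrA; apply/eqP.
have gC := gammaC oU g_sym; have UFx := FU Vx.
have NC a b c : N a b c = N b a c.
  rewrite !mxE A_dmxC //; congr (_ + _ - _); last first.
    by apply: eq_bigr => s _; rewrite gC //; exact: VU.
  transitivity (\sum_s \sum_t A x b s * A x a t * gamma g t (F x) s c).
    by apply: eq_bigr => s _; rewrite summxE mulr_sumr;
      apply: eq_bigr => t _; rewrite mxE mulrA.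
  rewrite exchange_big /=; apply: eq_bigr => s _; rewrite summxE mulr_sumr.
  by apply: eq_bigr => t _; rewrite [in RHS]mxE mulrA (mulrC (A x b t)) gC.
have GT : G^T = G by exact: g_sym.
have NS a : N a *m G *m (A x)^T + (N a *m G *m (A x)^T)^T = 0.
  have [dAG EAG] := dmxM (A_derivable Vx) (A_chain g_smooth Vx).1.
  have [dAT EAT] := dmx_tr (A_derivable Vx).
  have [_ E] := dmxM dAG dAT.
  have := E a; rewrite (dmx_eq a oV Vx A_metric) (gamma_metric oU g_sym g_unit a (VU Vx)).
  rewrite EAT EAG (A_chain g_smooth Vx).2.
  have -> : \sum_b A x a b *: dmx b g (F x) = pull_gamma a x *m G + G *m (pull_gamma a x)^T.
    rewrite /pull_gamma mulmx_suml raddf_sum /= mulmx_sumr -big_split; apply: eq_bigr => b _ /=.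
    by rewrite (gamma_metric oU g_sym g_unit b UFx) linearZ /= -scalemxAl -scalemxAr scalerDr.
  rewrite -(A_metric Vx) -/G => /esym; exact: metric_derivative_cancel.
have S0 := @skew_sym3 (fun a b c => (N a *m G *m (A x)^T) b c).
have Ni0 : N i *m (G *m (A x)^T) = 0.
  apply/matrixP => b c; rewrite mulmxA [RHS]mxE; apply: S0.
  - move=> a1 b1 c1; have := congr1 (fun M : 'M[R]_4 => M b1 c1) (NS a1).
    by rewrite !mxE => /eqP; rewrite addr_eq0 => /eqP.
  - move=> a1 b1 c1; rewrite -!mulmxA !(mxE _ _ b1) !(mxE _ _ a1).
    by apply: eq_bigr => s _; rewrite NC.
have UGA : G *m (A x)^T \in unitmx by rewrite unitmx_mul g_unit // unitmx_tr A_unit.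
by rewrite -[N i](mulmxK UGA) Ni0 mul0mx.
Qed.

Lemma curv_cancel (C0 C1 B P0 P1 dC0 dC1 Q0 Q1 : 'M[R]_4) :
  (dC0 *m B + C0 *m (C1 *m B - B *m P1)) - ((C1 *m B - B *m P1) *m P0 + B *m Q0) =
  (dC1 *m B + C1 *m (C0 *m B - B *m P0)) - ((C0 *m B - B *m P0) *m P1 + B *m Q1) ->
  (dC0 - dC1 + (C0 *m C1 - C1 *m C0)) *m B = B *m (Q0 - Q1 + (P0 *m P1 - P1 *m P0)).
Proof.
move=> /eqP; rewrite -subr_eq0 => /eqP E; apply/eqP; rewrite -subr_eq0; apply/eqP.
rewrite -[RHS]E !(mulmxDl, mulmxDr, mulmxBl, mulmxBr, mulNmx, mulmxN, mulmxA).
by apply/matrixP => i j; rewrite !mx_addoppE; ring.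
Qed.

(** [dmxA_gamma] is a first-order system for the Jacobian matrix, and its integrability condition,
    the equality of mixed second derivatives, is the equality of curvatures. *)
Lemma curv_pull i j x : V x ->
  curv g i j x *m A x =
  A x *m \sum_a \sum_b (A x i a * A x j b) *: curv g a b (F x).
Proof.
move=> Vx; have UFx := FU Vx.
have dG l : mx_derivable (gamma g l) x by exact: smooth_mx_derivable (gamma_smooth l) (VU Vx).
have dP l := (pull_gamma_derivable Vx l).1.
have DD l p : dmx l (dmx p A) x =
    (dmx l (gamma g p) x *m A x + gamma g p x *m dmx l A x)
    - (dmx l A x *m pull_gamma p x + A x *m dmx l (pull_gamma p) x).
  have [dGA EGA] := dmxM (dG p) (A_derivable Vx).
  have [dAP EAP] := dmxM (A_derivable Vx) (dP p).
  rewrite (dmx_eq l oV Vx (fun z Vz => dmxA_gamma p Vz)).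
  by rewrite (dmxB dGA dAP) EGA EAP.
have := dmx_dmxC j i Vx; rewrite !DD !dmxA_gamma // => /curv_cancel.
rewrite /curv => ->; congr (_ *m _).
(* The terms containing derivatives of [A] are symmetric in [i] and [j] and cancel. *)
have E0 : \sum_a dmx j A x i a *: gamma g a (F x) = \sum_a dmx i A x j a *: gamma g a (F x).
  by apply: eq_bigr => a _; rewrite A_dmxC.
rewrite !(pull_gamma_derivable Vx _).2 E0.
have E3 (S0 S1 S2 : 'M[R]_4) : S0 + S1 - (S0 + S2) = S1 - S2.
  by rewrite opprD addrACA subrr add0r.
rewrite E3.
have E1 : \sum_a \sum_b (A x j a * A x i b) *: dmx b (gamma g a) (F x) =
    \sum_a \sum_b (A x i a * A x j b) *: dmx a (gamma g b) (F x).
  rewrite exchange_big; apply: eq_bigr => a _; apply: eq_bigr => b _.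
  by rewrite mulrC.
have E2 l p : pull_gamma l x *m pull_gamma p x =
    \sum_a \sum_b (A x l a * A x p b) *: (gamma g a (F x) *m gamma g b (F x)).
  rewrite /pull_gamma mulmx_suml; apply: eq_bigr => a _; rewrite mulmx_sumr.
  by apply: eq_bigr => b _; rewrite -scalemxAl -scalemxAr scalerA.
rewrite E1 (E2 i j) (E2 j i) [X in _ + (_ - X)]exchange_big /= -!sumrB -big_split.
apply: eq_bigr => a _ /=; rewrite -!sumrB -big_split; apply: eq_bigr => b _ /=.
by rewrite [A x j b * _]mulrC -!scalerBr -scalerDr.
Qed.

Definition curv_low i j x : 'M[R]_4 := curv g i j x *m g x.

Lemma curv_low_pull i j x : V x -> curv_low i j x =
  \sum_a \sum_b (A x i a * A x j b) *: (A x *m curv_low a b (F x) *m (A x)^T).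
Proof.
move=> Vx; rewrite /curv_low -(A_metric Vx) !mulmxA curv_pull // -!mulmxA mulmx_suml mulmx_sumr.
apply: eq_bigr => a _; rewrite mulmx_suml mulmx_sumr; apply: eq_bigr => b _.
by rewrite -scalemxAl -scalemxAr !mulmxA.
Qed.

(** The derivatives of [A] given by the product rule are, by [dmxA_gamma], exactly what exchanges
    the connection at [x] for the one at [F x]. *)
Lemma nabla_pull (Z : pt -> 'M[R]_4) i x : smooth_mx_on U Z -> V x ->
  nabla_form g (fun z => A z *m Z (F z) *m (A z)^T) i x =
  \sum_a A x i a *: (A x *m nabla_form g Z a (F x) *m (A x)^T).
Proof.
move=> sZ Vx; have [dZ EZ] := A_chain sZ Vx.
have [dAZ EAZ] := dmxM (A_derivable Vx) dZ; have [dAT EAT] := dmx_tr (A_derivable Vx).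
have [_ E] := dmxM dAZ dAT.
rewrite nabla_formE E EAT EAZ EZ dmxA_gamma //.
have -> : \sum_a A x i a *: (A x *m nabla_form g Z a (F x) *m (A x)^T) =
   A x *m (\sum_a A x i a *: dmx a Z (F x) - pull_gamma i x *m Z (F x)
           - Z (F x) *m (pull_gamma i x)^T) *m (A x)^T.
  have E1 : pull_gamma i x *m Z (F x) = \sum_a A x i a *: (gamma g a (F x) *m Z (F x)).
    by rewrite mulmx_suml; apply: eq_bigr => a _; rewrite scalemxAl.
  have E2 : Z (F x) *m (pull_gamma i x)^T = \sum_a A x i a *: (Z (F x) *m (gamma g a (F x))^T).
    rewrite [(pull_gamma i x)^T]raddf_sum mulmx_sumr; apply: eq_bigr => a _.
    by rewrite /= linearZ /= scalemxAr.
  rewrite E1 E2 -!sumrB mulmx_sumr mulmx_suml; apply: eq_bigr => a _.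
  by rewrite nabla_formE -!scalerBr -scalemxAr -scalemxAl.
rewrite !(raddfB, raddfD) /= !trmx_mul.
rewrite !(mulmxDl, mulmxDr, mulmxBl, mulmxBr, mulNmx, mulmxN, mulmxA).
by apply/matrixP => p q; rewrite !mx_addoppE; ring.
Qed.

Variables (K : R) (zeta eta : pt -> 'M[R]_4) (alpha beta : pt -> 'rV[R]_4).
Hypothesis zeta_smooth : smooth_mx_on U zeta.
Hypothesis zeta01 : forall x, U x -> zeta x o0 o1 != 0.
Hypothesis frame_ip : forall x, U x ->
  [/\ ip2 (g x) (zeta x) (zeta x) = 0, ip2 (g x) (zeta x) (eta x) = 0,
      ip2 (g x) (eta x) (zeta x) = 0 & ip2 (g x) (eta x) (eta x) = - 2].
Hypothesis curvature : forall x, U x -> forall i j l p, riem g i j l p x =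
    K * (g x i l * g x j p - g x j l * g x i p)
    + 2^-1 * (zeta x i j * eta x l p + eta x i j * zeta x l p).
Hypothesis nabla_zeta : forall x, U x -> forall i, nabla_form g zeta i x =
  (2 * alpha x 0 i) *: zeta x + (2 * beta x 0 i) *: eta x.

Lemma curv_lowE x i j l p : curv_low i j x l p = riem g i j l p x.
Proof. by rewrite mxE; apply: eq_bigr => s _; rewrite curvE. Qed.

Lemma riem_pull x i j l p : V x ->
  riem g i j l p x = pull4 (A x) (fun a b c d => riem g a b c d (F x)) i j l p.
Proof.
move=> Vx; rewrite -curv_lowE.
rewrite curv_low_pull //.
rewrite summxE; apply: eq_bigr => a _; rewrite summxE; apply: eq_bigr => b _.
rewrite mxE congruenceE mulr_sumr; apply: eq_bigr => c _; rewrite mulr_sumr.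
by apply: eq_bigr => d _; rewrite curv_lowE mulrA.
Qed.

(** The constant curvature parts match because the metric is preserved. What remains of [riem_pull]
    is the hypothesis of [frame_unique], and the inner products survive the congruence by [A x]. *)
Lemma frame_pull x : V x -> exists2 s : R, s * s = 1 &
  A x *m zeta (F x) *m (A x)^T = s *: zeta x /\
  A x *m eta (F x) *m (A x)^T = s *: eta x.
Proof.
move=> Vx; have Ux := VU Vx; have UFx := FU Vx.
have uA : A x \in unitmx := A_unit Vx.
apply: (frame_unique (g_unit Ux) _ (frame_ip Ux) _ (zeta01 Ux)); last first.
  by rewrite -(A_metric Vx) !ip2_congruence ?g_unit //; exact: frame_ip.
move=> i j l p; have := riem_pull i j l p Vx.
rewrite (@eq_pull4 _ (A x) _ _ i j l p (curvature UFx)) pull4_linear.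
rewrite curvature // -(A_metric Vx).
set G := g (F x); set Z := zeta (F x); set E := eta (F x).
have E1 : pull4 (A x) (fun a b c d => G a c * G b d - G b c * G a d) i j l p =
    (A x *m G *m (A x)^T) i l * (A x *m G *m (A x)^T) j p -
    (A x *m G *m (A x)^T) j l * (A x *m G *m (A x)^T) i p.
  rewrite (@eq_pull4 _ (A x) _
    (fun a b c d => 1 * (G a c * G b d) + -1 * (G b c * G a d))); last first.
    by move=> a b c d; ring.
  rewrite pull4_linear [X in 1 * X]pull4_swap23 pull4_tensor.
  by rewrite [X in - 1 * X]pull4_swap12 [X in - 1 * X]pull4_swap23 pull4_tensor; ring.
have E2 : pull4 (A x) (fun a b c d => Z a b * E c d + E a b * Z c d) i j l p =
    (A x *m Z *m (A x)^T) i j * (A x *m E *m (A x)^T) l p +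
    (A x *m E *m (A x)^T) i j * (A x *m Z *m (A x)^T) l p.
  rewrite (@eq_pull4 _ (A x) _
    (fun a b c d => 1 * (Z a b * E c d) + 1 * (E a b * Z c d))); last first.
    by move=> a b c d; ring.
  by rewrite pull4_linear !pull4_tensor; ring.
rewrite E1 E2 => /addrI /(mulfI _); apply.
by rewrite invr_eq0 pnatr_eq0.
Qed.

Lemma frame_pull_near x : V x -> exists2 s : R, s * s = 1 &
  A x *m eta (F x) *m (A x)^T = s *: eta x /\
  \forall z \near x, A z *m zeta (F z) *m (A z)^T = s *: zeta z.
Proof.
move=> Vx; have [s ss [Zs Es]] := frame_pull Vx; exists s => //; split=> //.
(* If [t] is the sign at z, then f z is t s times a positive square. As f is continuous and positive
   at x, the signs t and s agree near x. *)
pose f z := (A z *m zeta (F z) *m (A z)^T) o0 o1 * s * zeta z o0 o1.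
have f0 : 0 < f x.
  rewrite /f Zs mxE [s * _ * s]mulrAC ss mul1r -expr2 exprn_even_gt0 //=.
  exact: zeta01 (VU Vx).
have cf : {for x, continuous f}.
  have cA := smooth_mx_continuous A_smooth Vx.
  have cZ := mx_continuousM
    (mx_continuousM cA (F_continuous zeta_smooth Vx)) (mx_continuousT cA).
  have cs : {for x, continuous (fun _ : pt => s)} by exact: cst_continuous.
  have cz := smooth_mx_continuous zeta_smooth (VU Vx).
  exact: (continuousM (continuousM (cZ o0 o1) cs) (cz o0 o1)).
have nV := open_nbhs_nbhs (conj oV Vx).
have nf : \forall z \near x, 0 < f z by exact: (cvgr_gt (f x) cf).
apply: filterS2 nV nf => z Vz.
have [t tt [Zt _]] := frame_pull Vz; rewrite /f Zt mxE => f_gt0.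
suff -> : s = t by [].
have z2 : 0 < zeta z o0 o1 ^+ 2 by rewrite exprn_even_gt0 //=; exact: zeta01 (VU Vz).
have st : 0 < t * s.
  by rewrite -(pmulr_lgt0 _ z2) expr2 mulrACA mulrA.
have /eqP : (t * s - 1) * (t * s + 1) = 0.
  transitivity ((t * t) * (s * s) - 1); first by ring.
  by rewrite tt ss mulr1 subrr.
rewrite mulf_eq0 subr_eq0 addr_eq0 => /orP[/eqP ts1|/eqP ts1].
  by rewrite -[RHS]mulr1 -ss mulrA ts1 mul1r.
by move: st; rewrite ts1 ltr0N1.
Qed.

(** The sign [s], constant near [x], commutes with the covariant derivative and multiplies both zeta
    and eta, so it drops out when coefficients are compared. *)
Lemma alpha_pull x i : V x -> alpha x 0 i = \sum_a A x i a * alpha (F x) 0 a.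
Proof.
move=> Vx; have Ux := VU Vx; have UFx := FU Vx.
have [s ss [Es nZ]] := frame_pull_near Vx; have Zs := nbhs_singleton nZ.
have s0 : s != 0.
  by apply/eqP => s0; move: ss; rewrite s0 mul0r => /eqP; rewrite eq_sym oner_eq0.
have := nabla_pull i zeta_smooth Vx.
have -> : nabla_form g (fun z => A z *m zeta (F z) *m (A z)^T) i x = s *: nabla_form g zeta i x.
  rewrite (nabla_form_near _ _ nZ) nabla_form_scale //.
  exact: smooth_mx_derivable zeta_smooth Ux.
have -> : \sum_a A x i a *: (A x *m nabla_form g zeta a (F x) *m (A x)^T) =
    s *: ((2 * \sum_a A x i a * alpha (F x) 0 a) *: zeta x
          + (2 * \sum_a A x i a * beta (F x) 0 a) *: eta x).
  rewrite !mulr_sumr !scaler_suml -big_split /= scaler_sumr; apply: eq_bigr => a _.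
  rewrite nabla_zeta // mulmxDr mulmxDl -!scalemxAr -!scalemxAl Zs Es.
  by apply/matrixP => b c; rewrite !mxE; ring.
move/(scalerI s0); rewrite nabla_zeta //.
set a0 := alpha x 0 i; set b0 := beta x 0 i.
set a1 := \sum_a _; set b1 := \sum_a _ => E.
have [zz ze ez ee] := frame_ip Ux.
(* Pairing with eta kills zeta and isolates the coefficient of eta. *)
have Eb : b0 = b1.
  have := congr1 (fun Z => ip2 (g x) Z (eta x)) E.
  by rewrite /= !ip2_linearl ze ee !mulr0 !add0r; lra.
move: E; rewrite Eb => /addIr /matrixP /(_ o0 o1); rewrite !mxE.
by move=> /(mulIf (zeta01 Ux)); lra.
Qed.

Lemma alpha_norm_pull x : V x ->
  alpha x *m invmx (g x) *m (alpha x)^T = alpha (F x) *m invmx (g (F x)) *m (alpha (F x))^T.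
Proof.
move=> Vx; have uA : A x \in unitmx := A_unit Vx.
have -> : alpha x = alpha (F x) *m (A x)^T.
  apply/rowP => i; rewrite alpha_pull // mxE; apply: eq_bigr => a _.
  by rewrite mxE mulrC.
rewrite -(A_metric Vx) (invmx_congruence uA (g_unit (FU Vx))) trmx_mul trmxK !mulmxA.
rewrite -[_ *m (A x)^T *m _]mulmxA -trmx_mul mulVmx // trmx1 mulmx1.
by rewrite -[_ *m invmx (A x) *m A x]mulmxA mulVmx // mulmx1.
Qed.

End Pullback.

(** * A non-constant invariant of local isometries *)

Section LocalHomogeneity.
Variables (R : realType) (K k : R) (fam : bool -> R -> R).
Hypothesis fam_smooth : forall b, smooth_line (fam b).
Local Notation pt := 'rV[R]_4.
Local Notation ev := (eval fam).

Variable g : pt -> 'M[R]_4.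
Hypothesis gE : forall x, halfspace x -> forall i j, g x i j = ev (@metric_tab R K k i j) x.

Lemma metric_unit x : halfspace x -> g x \in unitmx.
Proof. by move=> x3; rewrite unitmxE (det_gE gE) // unitfE expf_neq0 // gt_eqF. Qed.

Lemma gamma_smooth_halfspace i : smooth_mx_on halfspace (gamma g i).
Proof.
move=> j l r; apply: (Ck_eq (@halfspace_open R))
  (eval_smooth fam_smooth (@christoffel_tab R K k l i j) r) => x x3.
by rewrite gammaE (christoffelE fam_smooth gE).
Qed.

Section JacobianMatrix.
Variables (V V' : set pt) (F H : pt -> pt).
Hypothesis oV : open V.
Hypothesis VU : V `<=` halfspace.
Hypothesis V'U : V' `<=` halfspace.
Hypothesis isoF : Defs.isometry g V V' F H.

Lemma iso_maps x : V x -> halfspace (F x).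
Proof. by case: isoF => _ _ FV _ _ /FV [/V'U]. Qed.

Lemma diff_entry i j : (fun z => diff_mx F z i j) = partial i (fun z => F z 0 j).
Proof. by apply/funext => z; rewrite mxE. Qed.

Lemma diff_smooth : smooth_mx_on V (diff_mx F).
Proof.
move=> i j n; have [sF _ _ _ _] := isoF; have [_ /(_ i)[_ C]] := sF j n.+1.
by rewrite diff_entry.
Qed.

Lemma dmx_diffC i j l x : V x -> dmx i (diff_mx F) x j l = dmx j (diff_mx F) x i l.
Proof.
move=> Vx; have [sF _ _ _ _] := isoF.
have E1 := dmxE i (diff_mx F) x j l; have E2 := dmxE j (diff_mx F) x i l.
rewrite (diff_entry j l) in E1; rewrite (diff_entry i l) in E2.
exact: etrans E1 (etrans (partialC i j oV Vx (sF l 2)) (esym E2)).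
Qed.

Lemma dmx_comp p q (M : pt -> 'M[R]_(p, q)) x : smooth_mx_on halfspace M -> V x ->
  mx_derivable (fun z => M (F z)) x /\
  forall i, dmx i (fun z => M (F z)) x = \sum_a diff_mx F x i a *: dmx a M (F x).
Proof.
move=> sM Vx; have [sF _ _ _ _] := isoF.
have D i j l := partial_comp (@halfspace_open R) oV Vx (iso_maps Vx) (sM j l 1)
  (fun a => let: conj _ c := sF a 1 in let: conj d _ := c i in d x Vx).
split=> [i j l|i]; first by have [] := D i j l.
apply/matrixP => j l; have [_ E] := D i j l.
rewrite dmxE [LHS]E summxE; apply: eq_bigr => a _.
by rewrite mxE dmxE; congr (_ * _); rewrite mxE.
Qed.

Lemma F_continuous (x : pt) : V x -> {for x, continuous F}.
Proof.
move=> Vx; have [sF _ _ _ _] := isoF.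
apply/(@cvgrPdist_le _ _ _ (nbhs x) (nbhs_filter x)) => e e0.
have N : \forall z \near x, forall j, `|F x 0 j - F z 0 j| <= e.
  apply: (filter_forall (nbhs_filter (x : pt))) => j; have [c _] := sF j 0.
  by have /cvgrPdist_le /(_ _ e0) := c x Vx.
apply: filterS N => z Nz; apply: norm_row_le; first exact: ltW.
by move=> j; have := Nz j; rewrite !mxE.
Qed.

Lemma comp_continuous M x : smooth_mx_on halfspace M -> V x ->
  mx_continuous (fun z => M (F z)) x.
Proof.
move=> sM Vx i j; have [c _] := sM i j 0.
exact: (continuous_comp (F_continuous Vx) (c _ (iso_maps Vx))).
Qed.

Lemma alpha_norm_isometry x : V x ->
  alpha_row K k fam x *m invmx (g x) *m (alpha_row K k fam x)^T =
  alpha_row K k fam (F x) *m invmx (g (F x)) *m (alpha_row K k fam (F x))^T.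
Proof.
move=> Vx.
apply: (alpha_norm_pull (@halfspace_open R) (metric_sym gE) metric_unit
  (metric_smooth fam_smooth gE) gamma_smooth_halfspace oV VU iso_maps diff_smooth dmx_diffC
  dmx_comp comp_continuous _ (tab_smooth fam_smooth (@zeta_tab R)) _ _ _
  (nabla_zeta fam_smooth gE) Vx).
- by case: isoF.
- by move=> z z3; rewrite mxE /= mulf_neq0 // ?invr_eq0 ?pnatr_eq0 // gt_eqF.
- by move=> z z3; have [? ? ? ? _] := ip2_frame gE z3.
- move=> z z3 i j l p; rewrite (riemE fam_smooth gE) // !mxE.
  by congr (K * _ + _).
Qed.

End JacobianMatrix.

Lemma alpha_norm x : halfspace x ->
  (alpha_row K k fam x *m invmx (g x) *m (alpha_row K k fam x)^T) 0 0 =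
  - 2 * K - 2 * (k - x 0 o0) / x 0 o3 ^+ 2.
Proof.
move=> x3; have x3n : x 0 o3 != 0 by rewrite gt_eqF.
have giE i j : invmx (g x) i j = ev (inverse_tab K k i j) x := inverseE gE x3 i j.
by rewrite !mxE sum4 !mxE !sum4 !giE !mxE /=; field.
Qed.

Lemma not_locally_homogeneous_halfspace : ~ locally_homogeneous g halfspace.
Proof.
(* At these points lambda(c, c) = 1 and v = t, so the norm of alpha is - 2 K - 2 / t^2. *)
pose pnt (t : R) : pt := \row_i (if i == o0 then k - 1 else if i == o3 then t else 0).
have [t1 t2] : 0 < 1 :> R /\ 0 < 2 :> R by split; rewrite ?ltr01 ?ltr0n.
have h (t : R) : 0 < t -> halfspace (pnt t) by move=> t0; rewrite /halfspace /= mxE.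
have n (t : R) : 0 < t ->
    (alpha_row K k fam (pnt t) *m invmx (g (pnt t)) *m (alpha_row K k fam (pnt t))^T) 0 0
    = - 2 * K - 2 / t ^+ 2.
  move=> t0; rewrite alpha_norm; last exact: h.
  by rewrite !mxE /=; congr (_ - _ / _); ring.
move=> /(_ (pnt 1) (pnt 2) (h _ t1) (h _ t2)).
move=> [V [V' [F [H [[oV VU Vx] [[_ V'U _] [isoF Fx]]]]]]].
have := alpha_norm_isometry oV VU V'U isoF Vx; rewrite Fx.
move=> /(congr1 (fun M : 'M[R]_1 => M 0 0)); rewrite !n //.
by rewrite expr1n expr2; lra.
Qed.

End LocalHomogeneity.

(** * The metric of a two-plane system in the coordinates *)

Section TwoPlaneAlgebra.
Variables (R : realType) (S : two_plane_system R) (a : Pi S).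
Local Notation c := (cvec S).
Local Notation Om := (@Omega R S).
Hypothesis Omega_ac : Om a c = 1.

Lemma scalar_comb (W : lmodType R) (f : W -> R) t s x z : scalar f ->
  f (t *: x + s *: z) = t * f x + s * f z.
Proof.
move=> fs; have f0 : f 0 = 0.
  by have := fs 1 0 0; rewrite scaler0 addr0 mul1r => E; lra.
by rewrite fs; congr (_ + _); have := fs s z 0; rewrite !addr0 f0 addr0.
Qed.

Lemma Omega_combr z t s x x' : Om z (t *: x + s *: x') = t * Om z x + s * Om z x'.
Proof. exact: scalar_comb (@Omega_scalar _ S z). Qed.

Lemma Omega_combl z t s x x' : Om (t *: x + s *: x') z = t * Om x z + s * Om x' z.
Proof. exact: (@scalar_comb _ (fun w => Om w z)) (@Omega_scalarl _ S z). Qed.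

Lemma Omega_id x : Om x x = 0.
Proof. by have := @Omega_antisym _ S x x; lra. Qed.

Lemma Omega_ca : Om c a = - 1.
Proof. by rewrite Omega_antisym Omega_ac. Qed.

Lemma basis_decomp (X : Pi S) : X = - Om X a *: c + Om X c *: a.
Proof.
have Om0 z : Om z 0 = 0.
  by have := Omega_combr z 0 0 0 0; rewrite !scaler0 addr0 !mul0r addr0.
have fr : free [:: c; a].
  apply/(@freeP _ _ 2 [tuple c; a]) => h.
  rewrite !big_ord_recl big_ord0 addr0 /= => E.
  have Ec := congr1 (Om c) E; have Ea := congr1 (Om a) E.
  rewrite !Omega_combr !Omega_id Omega_ac Omega_ca !Om0 in Ec Ea.
  have h0 : h ord0 = 0 by lra.
  have h1 : h (lift ord0 ord0) = 0 by lra.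
  by case=> [[|[|i]] ilt] //; [rewrite -[RHS]h0|rewrite -[RHS]h1];
    congr (h _); exact: val_inj.
have ba : basis_of fullv [:: c; a] by rewrite basisEfree fr subvf dim_Pi.
have := coord_basis (X := [tuple c; a]) ba (memvf X).
rewrite !big_ord_recl big_ord0 addr0 /=.
move: (coord _ _ _) (coord _ _ _) => t s E.
have -> : Om X a = - s by rewrite E Omega_combl Omega_id Omega_ca; ring.
have -> : Om X c = t by rewrite E Omega_combl Omega_id Omega_ac; ring.
by rewrite opprK.
Qed.

End TwoPlaneAlgebra.

(** * The constructed metric and its components *)

Section TwoPlaneMetric.
Variables (R : realType) (S : two_plane_system R) (y : affine_coords S) (a : Pi S).
Local Notation c := (cvec S).
Local Notation Om := (@Omega R S).
Local Notation Sg := (Sigma S).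
Local Notation dSg := (direction (Sigma S)).
Hypothesis Omega_ac : Om a c = 1.
Variables (K k : R) (laa lac : R -> R).
Hypothesis laa_smooth : smooth_line laa.
Hypothesis lac_smooth : smooth_line lac.
Variables (q : Sg -> Pi S) (lam mu : Sg -> Pi S -> Pi S -> R).
Hypothesis q0 : forall p, q p = 0.
Hypothesis mu0 : forall p u v, mu p u v = 0.
Hypothesis lam_symm : forall p, symmetric_bilinear (lam p).
Hypothesis lam_cc : forall p, lam p c c = k - y1 y p.
Hypothesis lam_aa : forall p, lam p a a = laa (y1 y p).
Hypothesis lam_ac : forall p, lam p a c = lac (y1 y p).

(** The only candidate, by [is_gtilde_unique]: split each vector (w, u) into (w, Fw) and (0, u -
    Fw), which lie in the two null distributions, and keep the mixed products. *)
Definition gt_of (r : Sg -> R) (z : Sg * Pi S) (w w' : dSg * Pi S) : R :=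
  Om (Yvec z.2 w.1) (w'.2 - Ftot K q lam mu r z.1 z.2 w'.1)
  + Om (Yvec z.2 w'.1) (w.2 - Ftot K q lam mu r z.1 z.2 w.1).

Lemma OmegaB x u v : Om x (u - v) = Om x u - Om x v.
Proof. by have := Omega_combr x 1 (-1) u v; rewrite scale1r scaleN1r mul1r mulN1r. Qed.

Lemma Omega0r x : Om x 0 = 0.
Proof. by rewrite -(subrr 0) OmegaB subrr. Qed.

Lemma Omega0l x : Om 0 x = 0.
Proof. by rewrite Omega_antisym Omega0r oppr0. Qed.

Definition Fxi (r : Sg -> R) (p : Sg) (X : Pi S) : Pi S :=
  ((phi X)^-1 * lam p X X) *: c - (2 * Ffun q lam mu r p X / phi X ^+ 2) *: X.

Definition Ftau (r : Sg -> R) (p : Sg) (X : Pi S) : Pi S :=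
  (2^-1 * K * phi X + (phi X)^-1 * lam p c c) *: X
  - (2 * Ffun q lam mu r p X / phi X ^+ 2) *: c.

Lemma FtotE r p X w : Ftot K q lam mu r p X w = xi S w *: Fxi r p X + tau S w *: Ftau r p X.
Proof.
have lhs (A t B D f x1 x2 : R) (e1 e2 : Pi S) :
    A *: e1 + t *: (B *: e2 + D *: e1) - f *: (x1 *: e1 + x2 *: e2)
    = (A + t * D - f * x1) *: e1 + (t * B - f * x2) *: e2.
  rewrite !scalerDr !scalerA (addrC (_ *: e2)) addrA -scalerDl opprD -!scaleNr.
  by rewrite addrACA -!scalerDl.
have rhs (f B D x1 x2 : R) (e1 e2 : Pi S) :
    x1 *: (B *: e2 - f *: e1) + x2 *: (D *: e1 - f *: e2)
    = (x2 * D - x1 * f) *: e1 + (x1 * B - x2 * f) *: e2.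
  rewrite !scalerBr !scalerA -!scaleNr [_ *: e2 + _]addrC addrACA -!scalerDl.
  by congr (_ *: _ + _); ring.
rewrite /Ftot /Fq /Fmu /FK /Flam /Fxi /Ftau q0 !mu0 Omega0l mul0r scale0r scaler0 subr0 addr0.
rewrite mulr0 !scale0r subr0 scaler0 addr0 /Yvec.
set f := 2 * _ / _.
by rewrite lhs rhs; congr (_ *: _ + _ *: _); ring.
Qed.

Lemma gt_of_is_gtilde r : is_gtilde K q lam mu r (gt_of r).
Proof.
move=> p X phi_gt0; set gt := gt_of r (p, X).
have xl t w w' : xi S (t *: w + w') = t * xi S w + xi S w' :> R by exact: linearP.
have tl t w w' : tau S (t *: w + w') = t * tau S w + tau S w' :> R by exact: linearP.
have [x0 t0] : xi S 0 = 0 :> R /\ tau S 0 = 0 :> R by split; exact: linear0.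
have Yc t w w' : Yvec X (t *: w + w') = t *: Yvec X w + Yvec X w' :> Pi S.
  by rewrite /Yvec xl tl !scalerDl scalerDr !scalerA addrACA.
have Fc t w w' : Ftot K q lam mu r p X (t *: w + w') =
    t *: Ftot K q lam mu r p X w + Ftot K q lam mu r p X w'.
  rewrite !FtotE xl tl; move: (Fxi r p X) (Ftau r p X) => f1 f2.
  by rewrite !scalerDl scalerDr !scalerA addrACA.
have Y0 : Yvec X (0 : dSg) = 0 by rewrite /Yvec x0 t0 !scale0r addr0.
have F0 : Ftot K q lam mu r p X (0 : dSg) = 0.
  by rewrite FtotE x0 t0 !scale0r addr0.
have Yr z t u v : Om z (t *: u + v) = t * Om z u + Om z v by exact: (@Omega_scalar _ S).
have Yl z t u v : Om (t *: u + v) z = t * Om u z + Om v z by exact: (@Omega_scalarl _ S).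
split.
- split=> [[w u] t [w1 u1] [w2 u2]|[w u] [w' u']]; rewrite /gt /gt_of /=.
    rewrite Yc Fc Yl.
    have -> : t *: u1 + u2 - (t *: Ftot K q lam mu r p X w1 + Ftot K q lam mu r p X w2)
      = t *: (u1 - Ftot K q lam mu r p X w1) + (u2 - Ftot K q lam mu r p X w2).
      move: (Ftot _ _ _ _ _ _ _ w1) (Ftot _ _ _ _ _ _ _ w2) => f1 f2.
      by rewrite scalerBr opprD addrACA.
    by rewrite Yr; ring.
  by rewrite addrC.
- by move=> v v'; rewrite /gt /gt_of /= Y0 !Omega0l addr0.
- by move=> w w'; rewrite /gt /gt_of /= !subrr !Omega0r addr0.
- by move=> v w; rewrite /gt /gt_of /= Y0 F0 Omega0l add0r subr0.
Qed.

Lemma displacement_self (p : Sg) : displacement p p = 0.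
Proof.
have t0 : translate p 0 = p.
  by rewrite -{1}(displacementK p p) translateD addr0 displacementK.
by have := translateK p 0; rewrite t0.
Qed.

Lemma y1_translate p w : y1 y (translate p w) = y1 y p + xi S w.
Proof.
rewrite /y1 -{1}[p](displacementK (origin y)) translateD translateK linearD.
by [].
Qed.

Lemma lam_combr p z t s x x' : lam p z (t *: x + s *: x') = t * lam p z x + s * lam p z x'.
Proof. by have [l _] := lam_symm p; exact: scalar_comb (l z). Qed.

Lemma det_lam p : det_Omega (lam p) = laa (y1 y p) * (k - y1 y p) - lac (y1 y p) ^+ 2.
Proof.
have [_ lC] := lam_symm p.
rewrite (det_OmegaE (u := a) (v := c) (lam_symm p)) ?Omega_ac ?oner_neq0 //.
rewrite !Omega_id (Omega_ca Omega_ac) lam_aa lam_cc (lC c a) lam_ac.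
by rewrite mulr0 sub0r mul1r opprK divr1 expr2.
Qed.

Lemma y1_along1 p (t : R) : y1 y (translate p (t *: d1 y)) = y1 y p + t.
Proof. by rewrite y1_translate linearZ /= xi_d1 [t *: 1]mulr1. Qed.

Lemma y1_along2 p (t : R) : y1 y (translate p (t *: d2 y)) = y1 y p.
Proof. by rewrite y1_translate linearZ /= xi_d2 scaler0 addr0. Qed.

Lemma dy2_const (f : Sg -> R) p :
  (forall t : R, f (translate p (t *: d2 y)) = f p) -> dy2 y f p = 0.
Proof.
move=> ft; rewrite /dy2 (_ : (fun t : R => _) = cst (f p)) ?derive1_cst //.
exact/funext.
Qed.

(** The terms in u cancel because lambda(c, c) has slope - 1 in y1; the remaining multiples of phi
    determine s. As s depends on y1 alone, its derivative along [d2 y] is zero and r = 0. *)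
Lemma sr_equations_hold :
  sr_equations K q lam mu y a
    (fun p => - derive1 lac (y1 y p) - det_Omega (lam p)) (fun _ => 0).
Proof.
have dl (z : R) : derivable lac z 1 := @lac_smooth 0%N z.
have q2 (z : Pi S) p : dy2 y (fun p' => Om z (q p')) p = 0.
  by apply: dy2_const => t; rewrite !q0.
split=> [p X|p]; last first.
  have -> : dy1 y (fun p' => Om (q p') c) p = 0.
    rewrite /dy1 (_ : (fun t : R => _) = cst 0) ?derive1_cst //.
    by apply/funext => t; rewrite q0 Omega0l.
  rewrite dy2_const ?q0; last by move=> t; rewrite !det_lam y1_along2.
  by have := lam_combr p c 0 0 0 0; rewrite scaler0 addr0 !mul0r addr0 => ->; ring.
rewrite q2 mu0.
pose u := - Om X a; pose v := Om X c.
have XE : X = u *: c + v *: a by exact: basis_decomp.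
have lE p' : lam p' c X = u * (k - y1 y p') + v * lac (y1 y p').
  rewrite {1}XE lam_combr lam_cc; have [_ lC] := lam_symm p'.
  by rewrite (lC c a) lam_ac.
have -> : dy1 y (fun p' => lam p' c X) p = - u + v * derive1 lac (y1 y p).
  set z := y1 y p; pose h : R -> R := lac \o shift z.
  rewrite /dy1 (_ : (fun t : R => _) =
    cst (u * (k - z)) + (- u) *: (id : R -> R) + v *: h); last first.
    by apply/funext => t; rewrite lE y1_along1 (addrC z t);
      rewrite -[RHS]/(u * (k - z) + - u * t + v * lac (t + z)); ring.
  have dh : is_derive (0 : R) (1 : R) h (derive1 lac z).
    have ds : is_derive (0 : R) (1 : R) (shift z : R -> R) 1 by exact: is_derive_shift.
    have dsh : derivable (shift z : R -> R) 0 1 by case: ds.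
    have E := derive1_comp dsh (dl (shift z 0)).
    have dh : derivable h 0 1.
      by apply/derivable1_diffP/differentiable_comp; apply/derivable1_diffP.
    have ds1 : derive1 (shift z : R -> R) 0 = 1 by rewrite derive1E; exact: derive_val.
    split=> //; rewrite -derive1E [LHS]E ds1 mulr1.
    by rewrite /= add0r.
  have D := is_deriveD (is_deriveD (is_derive_cst (u * (k - z)) (0 : R) (1 : R))
    (is_deriveZ (- u) (is_derive_id (0 : R) (1 : R)))) (is_deriveZ v dh).
  rewrite derive1E; case: D => _ ->.
  by rewrite add0r -[_ *: (1 : R)]/(- u * 1) mulr1.
by rewrite /phi -/v /u; ring.
Qed.

Lemma OmegaZ x t u : Om x (t *: u) = t * Om x u.
Proof. by have := Omega_combr x t 0 u 0; rewrite scaler0 addr0 mul0r addr0. Qed.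

(** [Ffun] multiplies the skew expression Omega(Y_w, Y_w'), so it cancels in the symmetric sum. *)
Lemma gt_ofE r p X w u w' u' : phi X != 0 ->
  gt_of r (p, X) (w, u) (w', u') =
    Om (Yvec X w) u' + Om (Yvec X w') u
    - 2 * (xi S w : R) * (xi S w' : R) * lam p X X
    + (tau S w : R) * (tau S w' : R) * (K * phi X ^+ 2 + 2 * lam p c c).
Proof.
rewrite /phi => v0; rewrite /gt_of /= !FtotE !OmegaB.
rewrite /Yvec !Omega_combl !Omega_combr /Fxi /Ftau !OmegaB !OmegaZ /phi !Omega_id.
rewrite (Omega_antisym c X); move: (Om X c) v0 (Ffun _ _ _ _ _ _) => v v0 f.
move: (xi S w : R) (xi S w' : R) (tau S w : R) (tau S w' : R) => s1 s1' s2 s2'.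
by move: (lam p X X) (lam p c c) (Om X u) (Om c u) (Om X u') (Om c u') => *; field.
Qed.

Lemma chart_linE x : chart_lin y a x =
  (x 0 o0 *: d1 y + x 0 o1 *: d2 y, x 0 o2 *: c + x 0 o3 *: a).
Proof.
have e0 : x 0 (0 : 'I_4) = x 0 o0 by congr (x 0 _); exact: val_inj.
have e1 : x 0 (1 : 'I_4) = x 0 o1 by congr (x 0 _); exact: val_inj.
have e2 : x 0 (2%:R : 'I_4) = x 0 o2 by congr (x 0 _); exact: val_inj.
have e3 : x 0 (3%:R : 'I_4) = x 0 o3 by congr (x 0 _); exact: val_inj.
by rewrite /chart_lin e0 e1 e2 e3.
Qed.

Lemma chartE x : chart y a x =
  (translate (origin y) (x 0 o0 *: d1 y + x 0 o1 *: d2 y), x 0 o2 *: c + x 0 o3 *: a).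
Proof. by rewrite /chart chart_linE. Qed.

Lemma phi_comb (u v : R) : phi (u *: c + v *: a) = v.
Proof. by rewrite /phi Omega_combl Omega_id Omega_ac; ring. Qed.

Lemma chart_domE : chart_dom y a = @halfspace R.
Proof. by apply/funext => x; rewrite /chart_dom /halfspace /mkset chartE phi_comb. Qed.

Definition lam_fun (b : bool) : R -> R := if b then laa else lac.

(** The bridge between the two halves: it supplies the hypothesis [gE] on which all coordinate
    computations rest. *)
Lemma chart_metricE r x : halfspace x -> forall i j,
  chart_metric y a (gt_of r) x i j = eval lam_fun (metric_tab K k i j) x.
Proof.
move=> x3 i j; have x3n : x 0 o3 != 0 by rewrite gt_eqF.
rewrite mxE chartE !chart_linE; set p := translate _ _; set X := x 0 o2 *: c + _.
have phX : phi X = x 0 o3 by rewrite phi_comb.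
have xiE (s t : R) : xi S (s *: d1 y + t *: d2 y) = s :> R.
  by rewrite linearP linearZ /= xi_d1 xi_d2 scaler0 addr0 [s *: 1]mulr1.
have tauE (s t : R) : tau S (s *: d1 y + t *: d2 y) = t :> R.
  by rewrite linearP linearZ /= tau_d1 tau_d2 scaler0 add0r [t *: 1]mulr1.
have y1p : y1 y p = x 0 o0.
  by rewrite y1_translate xiE /y1 displacement_self linear0 add0r.
have lXX : lam p X X = eval lam_fun (Qx k) x.
  have [_ lC] := lam_symm p; rewrite /X lam_combr !(lC _ c) !(lC _ a) !lam_combr.
  by rewrite (lC c a) lam_cc lam_ac lam_aa y1p /=; ring.
rewrite gt_ofE ?phX // !xiE !tauE lXX lam_cc y1p /Yvec !xiE !tauE.
rewrite !Omega_combl !Omega_combr !Omega_id Omega_ac (Omega_ca Omega_ac).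
move: i j; do 2!apply: ord4P; rewrite !mxE /=; ring.
Qed.

End TwoPlaneMetric.

Theorem theorem22p2 (R : realType) (S : two_plane_system R)
    (y : affine_coords S) (a : Pi S) (Omega_ac : Omega a (cvec S) = 1)
    (K k : R) (laa lac : R -> R)
    (laa_smooth : smooth_line laa) (lac_smooth : smooth_line lac)
    (q : Sigma S -> Pi S) (lam mu : Sigma S -> Pi S -> Pi S -> R)
    (q0 : forall p, q p = 0) (mu0 : forall p u v, mu p u v = 0)
    (lam_symm : forall p, symmetric_bilinear (lam p))
    (lam_cc : forall p, lam p (cvec S) (cvec S) = k - y1 y p)
    (lam_aa : forall p, lam p a a = laa (y1 y p))
    (lam_ac : forall p, lam p a (cvec S) = lac (y1 y p)) :
  exists (s r : Sigma S -> R)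
    (gt : Sigma S * Pi S ->
          direction (Sigma S) * Pi S -> direction (Sigma S) * Pi S -> R),
    [/\ sr_equations K q lam mu y a s r,
        is_gtilde K q lam mu r gt
      & let M := chart_dom y a in
        let g := chart_metric y a gt in
        [/\ neutral_manifold g M,
            einstein g M,
            forall x, M x -> scal g x = 12 * K,
            exists o : bool,
              self_dual_petrov_III g M o /\ strictly_non_walker g M o
          & ~ locally_homogeneous g M]].
Proof.
pose fam := lam_fun laa lac.
have fam_smooth b : smooth_line (fam b) by case: b.
(* By [sr_equations_unique], no other pair solves the equations. *)
pose s p := - derive1 lac (y1 y p) - det_Omega (lam p).
pose r (p : Sigma S) : R := 0.
exists s, r, (gt_of K q lam mu r).
have gE := chart_metricE Omega_ac K q0 mu0 lam_symm lam_cc lam_aa lam_ac r.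
split.
- exact: (sr_equations_hold Omega_ac K lac_smooth q0 mu0 lam_symm lam_cc lam_aa lam_ac).
- exact: gt_of_is_gtilde.
cbv zeta; rewrite chart_domE //; split.
- exact: (neutral_manifold_halfspace fam_smooth gE).
- move=> x x3; rewrite (ricciE fam_smooth gE) //; rewrite (scalE fam_smooth gE) //.
  by congr (_ *: _); field.
- by move=> x x3; rewrite (scalE fam_smooth gE).
(* The orientation opposite to that of the coordinates (y1, y2, u, v) is the one for which zeta, eta
   and theta are self-dual. *)
- exists true; split; last exact: (strictly_non_walker_halfspace fam_smooth gE).
  split; first exact: (self_dual_halfspace fam_smooth gE).
  by move=> x x3; exact: (petrov_III_halfspace fam_smooth gE).
- exact: (not_locally_homogeneous_halfspace fam_smooth gE).
Qed.
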